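(* For all integers $m\ge2$, all $p\in(0,1)$ and all $\varepsilon>0$, there exists $C>0$ such that if $N\ge C p^{-(2m-1)}(\log(p^{-1}))^2$, then \[ t(K_m,p,N)=(1\pm\varepsilon)\,p^{\binom m2}(2N)^{\frac m2}, \] i.e. $(1-\varepsilon)p^{\binom m2}(2N)^{m/2}\le t(K_m,p,N)\le(1+\varepsilon)p^{\binom m2}(2N)^{m/2}$.
   Context: In the Subgraph Query Game with parameter $p\in(0,1)$, Builder plays alone on the random graph $G(\mathbb Z,p)$ with infinitely many vertices, whose edges are initially hidden. At each turn Builder queries (adaptively) one pair of vertices and is told whether it is an edge; equivalently, each queried edge is built successfully, independently, with probability $p$, and each pair may be queried at most once. For a graph $H$ with no isolated vertices, $t(H,p,N)$ is the maximum, over all Builder strategies, of the expected number of copies of $H$ built in $N$ turns. Copies are labeled: a copy of $H$ in a graph $G$ is an injective map $V(H)\to V(G)$ sending edges to edges (so each $K_m$ subgraph counts $m!$ times). $N$ is a positive integer and logarithms are natural. *)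

(* Defs.v *)
From HB Require Import structures.
From mathcomp Require Import all_boot all_order all_algebra finmap.
From mathcomp Require Import all_classical all_reals all_analysis.

Set Implicit Arguments.
Unset Strict Implicit.
Unset Printing Implicit Defensive.

Import Order.TTheory GRing.Theory Num.Theory.

Local Open Scope classical_set_scope.
Local Open Scope ring_scope.

(* A graph with finitely many edges on the vertex set Z is given by the list
   of its edges, each edge being a two-element set of vertices. *)
Definition pair_of_vertices := {fset int}.

(* The answers received so far determine the earlier queries, so a Builder
   strategy is a map from the list of past answers (oldest first, [true] for
   "is an edge") to the pair queried next.  Randomising would not change the
   maximum, since it only averages over deterministic strategies. *)
Definition strategy := seq bool -> pair_of_vertices.

Definition queries (s : strategy) (w : seq bool) : seq pair_of_vertices :=
  [seq s (take i w) | i <- iota 0 (size w)].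

Definition built (s : strategy) (w : seq bool) : seq pair_of_vertices :=
  mask w (queries s w).

(* Whatever the answers, the first N queries are distinct unordered pairs of
   distinct vertices. *)
Definition legal (N : nat) (s : strategy) : Prop :=
  forall w : N.-tuple bool,
    uniq (queries s w) /\ forall e, e \in queries s w -> #|` e| = 2%N.

Definition is_copy (V : finType) (H : rel V) (E : seq pair_of_vertices)
    (f : {ffun V -> int}) : Prop :=
  injective f /\ forall u v, H u v -> [fset f u; f v]%fset \in E.

(* [fset_set] is only meaningful on finite sets: see [finite_copies]. *)
Definition num_copies (V : finType) (H : rel V) (E : seq pair_of_vertices) :
  nat := #|` fset_set [set f | is_copy H E f]|.

(* A legal strategy never repeats a query, so the N answers are independent
   Bernoulli(p) variables: w has probability prod_i P(w_i). *)
Definition expected_copies (R : realType) (V : finType) (H : rel V) (p : R)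
    (N : nat) (s : strategy) : R :=
  \sum_(w : N.-tuple bool)
    (\prod_(b <- w) (if b then p else 1 - p)) * (num_copies H (built s w))%:R.

(* For H without isolated vertices this supremum is a maximum: see
   [max_copies_attained] and [max_copies_ub]. *)
Definition max_copies (R : realType) (V : finType) (H : rel V) (p : R)
    (N : nat) : R :=
  sup [set expected_copies H p N s | s in [set s | legal N s]].

Definition no_isolated (V : finType) (H : rel V) : Prop :=
  forall v, exists u, H v u.

Definition complete_graph (m : nat) : rel 'I_m := [rel i j | i != j].

Lemma complete_graph_no_isolated (m : nat) :
  (2 <= m)%N -> no_isolated (@complete_graph m).
Proof.
case: m => [|[|m]] // _ v; rewrite /complete_graph /=.
by case: (eqVneq v ord0) => [->|h]; [exists ord_max | exists ord0].
Qed.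

Lemma copies_sub (V : finType) (H : rel V) (E : seq pair_of_vertices)
    (D : {fset int}) : no_isolated H ->
  (forall e x, e \in E -> x \in e -> x \in D) ->
  [set f | is_copy H E f] `<=`
  [set` [seq [ffun v => val (g v)] | g : {ffun V -> D}]].
Proof.
move=> noH ED f [_ fE] /=.
have fD v : f v \in D.
  have [u vu] := noH v; apply: (ED _ _ (fE _ _ vu)).
  by rewrite !inE eqxx.
apply/mapP; exists [ffun v => [` fD v]%fset]; first by rewrite mem_enum.
by apply/ffunP => v; rewrite !ffunE.
Qed.

Lemma sub_bigfcup (E : seq pair_of_vertices) e x :
  e \in E -> x \in e -> x \in (\bigcup_(e <- E) e)%fset.
Proof. by move=> eE xe; apply/bigfcupP; exists e; rewrite ?eE. Qed.

Lemma finite_copies (V : finType) (H : rel V) (E : seq pair_of_vertices) :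
  no_isolated H -> finite_set [set f | is_copy H E f].
Proof.
move=> noH; apply: sub_finite_set (copies_sub noH (@sub_bigfcup E)) _.
exact: finite_seq.
Qed.

Lemma num_copies_le (V : finType) (H : rel V) (E : seq pair_of_vertices) :
  no_isolated H -> (forall e, e \in E -> #|` e| = 2%N) ->
  (num_copies H E <= (2 * size E) ^ #|V|)%N.
Proof.
move=> noH E2; rewrite /num_copies.
have DE : (#|` (\bigcup_(e <- E) e)%fset| <= 2 * size E)%N.
  elim: E E2 => [|e E IH] E2; first by rewrite big_nil cardfs0.
  rewrite big_cons /= (leq_trans (_ : _ <= #|` e| + #|` (\bigcup_(e <- E) e)%fset|)%N) //.
    by rewrite cardfsU leq_subr.
  rewrite mulnS (E2 e) ?mem_head // leq_add2l IH // => e' e'E.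
  by rewrite E2 // in_cons e'E orbT.
have S := copies_sub noH (@sub_bigfcup E).
have fin := finite_copies E noH.
apply: (@leq_trans #|{ffun V -> (\bigcup_(e <- E) e)%fset}|).
  rewrite -[leqRHS](size_image (fun g : {ffun V -> _} => [ffun v => val (g v)])).
  apply: uniq_leq_size; first exact: fset_uniq.
  by move=> f; rewrite in_fset_set // inE => /S.
rewrite card_ffun -cardfE.
by case: #|V| => [|k]; rewrite ?expn0 // leq_exp2r.
Qed.

Lemma legal_exists (N : nat) : exists s, legal N s.
Proof.
exists (fun h => [fset 0; (size h).+1%:Z]%fset) => w; split; last first.
  by move=> e /mapP[i _ ->]; rewrite cardfs2.
rewrite map_inj_in_uniq ?iota_uniq // => i j.
rewrite !mem_iota !add0n => /= iw jw /fsetP /(_ (size (take i w)).+1%:Z).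
by rewrite !inE eqxx orbT /= !size_take iw jw => /esym /eqP[].
Qed.

Lemma built_le (V : finType) (H : rel V) (N : nat) (s : strategy)
    (w : N.-tuple bool) : no_isolated H -> legal N s ->
  (num_copies H (built s w) <= (2 * N) ^ #|V|)%N.
Proof.
move=> noH ls.
have sz : (size (built s w) <= N)%N.
  rewrite (leq_trans (size_subseq (mask_subseq _ _))) //.
  by rewrite size_map size_iota size_tuple.
apply: leq_trans (num_copies_le noH _) _.
  by move=> e /mem_mask; apply: (ls w).2.
by case: #|V| => [|k]; rewrite ?expn0 // leq_exp2r // leq_mul2l sz.
Qed.

Lemma has_max_copies (R : realType) (V : finType) (H : rel V) (p : R)
    (N : nat) : no_isolated H ->
  exists2 s, legal N s &
    forall s', legal N s' -> expected_copies H p N s' <= expected_copies H p N s.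
Proof.
move=> noH; set B := ((2 * N) ^ #|V|)%N.
pose X (c : {ffun N.-tuple bool -> 'I_B.+1}) : R :=
  \sum_(w : N.-tuple bool) (\prod_(b <- w) (if b then p else 1 - p)) *
    (c w : nat)%:R.
pose code s : {ffun N.-tuple bool -> 'I_B.+1} :=
  [ffun w => inord (num_copies H (built s (tval w)))].
have codeE s : legal N s -> X (code s) = expected_copies H p N s.
  by move=> ls; apply: eq_bigr => w _; rewrite ffunE inordK // ltnS built_le.
have [s0 l0] := legal_exists N.
pose P c := `[< exists2 s, legal N s & code s = c >].
have P0 : P (code s0) by apply/asboolP; exists s0.
case: (arg_maxP X P0) => c /asboolP[s ls <-] cmax.
exists s => // s' ls'; rewrite -!codeE //; apply: cmax.
by apply/asboolP; exists s'.
Qed.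

Lemma max_copies_attained (R : realType) (V : finType) (H : rel V) (p : R)
    (N : nat) : no_isolated H ->
  exists2 s, legal N s & expected_copies H p N s = max_copies H p N.
Proof.
move=> noH; have [s ls smax] := has_max_copies p N noH; exists s => //.
apply/eqP; rewrite eq_le; apply/andP; split.
- apply: ub_le_sup; last by exists s.
  by exists (expected_copies H p N s) => _ [s' ls' <-]; exact: smax.
- apply: ge_sup; first by exists (expected_copies H p N s); exists s.
  by move=> _ [s' ls' <-]; exact: smax.
Qed.

Lemma max_copies_ub (R : realType) (V : finType) (H : rel V) (p : R)
    (N : nat) (s : strategy) : no_isolated H -> legal N s ->
  expected_copies H p N s <= max_copies H p N.
Proof.
move=> noH ls; have [s0 ls0 s0max] := has_max_copies p N noH.
apply: ub_le_sup; last by exists s.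
by exists (expected_copies H p N s0) => _ [s' ls' <-]; exact: s0max.
Qed.

(* Main.v *)
Require Import Defs.
From mathcomp Require Import all_boot all_order all_algebra finmap.
From mathcomp Require Import all_classical all_reals all_analysis.
From mathcomp Require Import zify ring lra.

(* As [C] may depend on [p], only the behaviour for large [s = sqrt (2 N)]
   matters.  The lower bound comes from querying all pairs of about [s]
   vertices.  For the upper bound let [Q] and [B] be the graphs of queried and
   built edges, and [M = B - p Q].  Replacing the [C(m, 2)] factors [B] of a
   clique count by [p Q] one at a time, each replacement costs at most the
   operator norm of [M] times the number of copies of [K_(m-1)] in [Q], which
   is at most [s ^ (m - 1)].  The operator norm is at most [tr (M ^ 4) ^ (1/4)],
   and since [M] is a martingale only the degenerate closed 4-walks contribute
   to the expectation of the trace: it is [O (N D)] if all degrees are at most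
   [D].  To enforce this with [D] of order [s], a query is ignored when one of
   its endpoints already has degree [D]; at most [s ^ 2 / D] vertices are
   affected, hence only a small proportion of the cliques. *)

Set Implicit Arguments.
Unset Strict Implicit.
Unset Printing Implicit Defensive.

Import Order.TTheory GRing.Theory Num.Theory.
Local Open Scope ring_scope.

(** * Sums over a finite type *)

Section FiniteSums.
Variables (R : realFieldType) (V : finType).
Implicit Types (D : V -> V -> R) (u v : V -> R).

Lemma cauchy_schwarz (I : finType) (a b : I -> R) :
  (\sum_i a i * b i) ^+ 2 <= (\sum_i a i ^+ 2) * (\sum_i b i ^+ 2).
Proof.
have : 0 <= \sum_i \sum_j (a i * b j - a j * b i) ^+ 2.
  by apply: sumr_ge0 => i _; apply: sumr_ge0 => j _; exact: sqr_ge0.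
have -> : \sum_i \sum_j (a i * b j - a j * b i) ^+ 2 =
    2 * ((\sum_i a i ^+ 2) * (\sum_i b i ^+ 2)) - 2 * (\sum_i a i * b i) ^+ 2.
  have -> : (\sum_i a i ^+ 2) * (\sum_i b i ^+ 2) =
      \sum_i \sum_j a i ^+ 2 * b j ^+ 2.
    by rewrite big_distrl; apply: eq_bigr => i _; rewrite big_distrr.
  have -> : (\sum_i a i * b i) ^+ 2 =
      \sum_i \sum_j (a i * b i) * (a j * b j).
    by rewrite expr2 big_distrl; apply: eq_bigr => i _; rewrite big_distrr.
  rewrite [2 * \sum_i \sum_j a i ^+ 2 * _]mulr_natl mulr2n.
  rewrite [X in _ + X - _]exchange_big.
  rewrite -big_split !mulr_sumr -sumrB; apply: eq_bigr => i _.
  rewrite -big_split mulr_sumr -sumrB; apply: eq_bigr => j _ /=; ring.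
lra.
Qed.

(* [tr (D ^ 4)] for symmetric [D]. *)
Definition quad_energy D := \sum_x \sum_y (\sum_z D x z * D z y) ^+ 2.

Lemma quad_energy_ge0 D : 0 <= quad_energy D.
Proof. by apply: sumr_ge0 => x _; apply: sumr_ge0 => y _; exact: sqr_ge0. Qed.

Lemma bilinear_quad_energy D u v : (forall x y, D x y = D y x) ->
  (\sum_x \sum_y D x y * (u x * v y)) ^+ 4 <=
  (\sum_x u x ^+ 2) ^+ 2 * (\sum_x v x ^+ 2) ^+ 2 * quad_energy D.
Proof.
move=> Dsym; pose w x := \sum_y D x y * v y.
have -> : \sum_x \sum_y D x y * (u x * v y) = \sum_x u x * w x.
  by apply: eq_bigr => x _; rewrite mulr_sumr; apply: eq_bigr => y _; ring.
have h1 := cauchy_schwarz u w.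
pose c x y := \sum_z D x z * D z y.
have E : \sum_x w x ^+ 2 = \sum_(xy : V * V) (v xy.1 * v xy.2) * c xy.1 xy.2.
  rewrite -(pair_big xpredT xpredT (fun x y => v x * v y * c x y)) /=.
  transitivity (\sum_z \sum_x \sum_y v x * v y * (D z x * D z y)).
    apply: eq_bigr => z _; rewrite expr2 mulr_suml; apply: eq_bigr => x _.
    by rewrite mulr_sumr; apply: eq_bigr => y _; ring.
  rewrite exchange_big; apply: eq_bigr => x _; rewrite exchange_big.
  by apply: eq_bigr => y _; rewrite mulr_sumr; apply: eq_bigr => z _; rewrite (Dsym z x).
have h2 : (\sum_x w x ^+ 2) ^+ 2 <= (\sum_x v x ^+ 2) ^+ 2 * quad_energy D.
  rewrite E; apply: le_trans (cauchy_schwarz _ _) _.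
  rewrite -(pair_big xpredT xpredT (fun x y => (v x * v y) ^+ 2)) /=.
  rewrite -(pair_big xpredT xpredT (fun x y => c x y ^+ 2)) /=.
  apply: ler_wpM2r; first exact: quad_energy_ge0.
  rewrite le_eqVlt; apply/orP; left; apply/eqP.
  rewrite expr2 mulr_suml; apply: eq_bigr => x _; rewrite mulr_sumr.
  by apply: eq_bigr => y _; ring.
have u0 : 0 <= \sum_x u x ^+ 2 by apply: sumr_ge0 => x _; exact: sqr_ge0.
apply: (@le_trans _ _ ((\sum_x u x ^+ 2) ^+ 2 * (\sum_x w x ^+ 2) ^+ 2)).
  rewrite -exprMn (_ : 4%N = (2 * 2)%N) // exprM ler_pXn2r // nnegrE ?sqr_ge0 //.
  by apply: mulr_ge0 => //; apply: sumr_ge0 => x _; exact: sqr_ge0.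
by rewrite -mulrA; apply: ler_wpM2l => //; exact: sqr_ge0.
Qed.

Lemma bilinear_le D u v (lam : R) : (forall x y, D x y = D y x) -> 0 < lam ->
  `|\sum_x \sum_y D x y * (u x * v y)| <=
  (lam + quad_energy D / lam ^+ 3) *
  ((\sum_x u x ^+ 2 + \sum_x v x ^+ 2) / 2).
Proof.
move=> Dsym lam0.
have := bilinear_quad_energy u v Dsym; have t0 := quad_energy_ge0 D.
set X := \sum_x _; set t := quad_energy D in t0 *.
set a := \sum_x u x ^+ 2; set b := \sum_x v x ^+ 2 => h.
have a0 : 0 <= a by apply: sumr_ge0 => x _; exact: sqr_ge0.
have b0 : 0 <= b by apply: sumr_ge0 => x _; exact: sqr_ge0.
set Y := (a + b) / 2; have Y0 : 0 <= Y by rewrite /Y; lra.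
have abY : a * b <= Y ^+ 2 by rewrite /Y; have := sqr_ge0 (a - b); lra.
have {}h : `|X| ^+ 4 <= Y ^+ 4 * t.
  rewrite -normrX ger0_norm; last by rewrite (_ : 4%N = (2 * 2)%N) // exprM sqr_ge0.
  apply: le_trans h _; apply: ler_wpM2r => //; rewrite -exprMn.
  rewrite (_ : 4%N = (2 * 2)%N) // exprM ler_pXn2r // nnegrE ?sqr_ge0 //.
  exact: mulr_ge0.
have l3 : 0 < lam ^+ 3 by rewrite exprn_gt0.
have tl : 0 <= t / lam ^+ 3 by rewrite divr_ge0 // ltW.
have [XY|YX] := lerP `|X| (lam * Y).
  by rewrite mulrDl (le_trans XY) // lerDl mulr_ge0.
have [Yz|Ynz] := eqVneq Y 0.
  move: h YX; rewrite Yz expr0n /= mul0r mulr0 => h YX.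
  by move: (exprn_gt0 4 YX); rewrite ltNge h.
have Yp : 0 < Y by rewrite lt_def Ynz.
rewrite mulrDl; apply: ler_wpDl; first by rewrite mulr_ge0 // ltW.
rewrite mulrAC ler_pdivlMr // -(ler_pM2r (exprn_gt0 3 Yp)).
apply: le_trans (_ : `|X| ^+ 4 <= _); last by rewrite -[in leRHS]mulrA -exprS mulrC.
rewrite -mulrA -exprMn [in leRHS]exprS; apply: ler_wpM2l => //.
rewrite ler_pXn2r ?nnegrE //; last by rewrite mulr_ge0 // ltW.
exact: ltW.
Qed.

Definition edge_ind (a b x y : V) : R :=
  ((x == a) && (y == b) || (x == b) && (y == a))%:R.

Lemma quad_energy_step D (d k : R) (a b : V) :
  a != b -> (forall x y, D x y = D y x) -> `|d| <= 1 ->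
  (forall x, \sum_y D x y ^+ 2 <= k) ->
  quad_energy (fun x y => D x y + d * edge_ind a b x y) <= quad_energy D +
    d * (2 * \sum_x \sum_y (\sum_z D x z * D z y) *
      (\sum_z (D x z * edge_ind a b z y + edge_ind a b x z * D z y))) +
    (36 * k + 16).
Proof.
move=> ab Dsym d1 Dk; set E := edge_ind a b.
pose D' x y := D x y + d * E x y; rewrite -/D'.
pose c x y := \sum_z D x z * D z y.
pose f x y := \sum_z (D x z * E z y + E x z * D z y).
pose g x y := \sum_z E x z * E z y.
have D'E x y : \sum_z D' x z * D' z y = c x y + d * f x y + d ^+ 2 * g x y.
  by rewrite /c /f /g !mulr_sumr -!big_split; apply: eq_bigr => z _ /=; rewrite /D'; ring.
have Eab x y : E x y = (x == a)%:R * (y == b)%:R + (x == b)%:R * (y == a)%:R.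
  rewrite /E /edge_ind; have [->|xa] := eqVneq x a;
    rewrite ?(negbTE ab) /= ?mul1r ?mul0r ?addr0 ?orbF //.
  by have [_|_] := eqVneq x b; rewrite /= ?mul1r ?mul0r ?add0r.
have pick (F : V -> R) x0 : \sum_z (z == x0)%:R * F z = F x0.
  rewrite (bigD1 x0) //= eqxx mul1r big1 ?addr0 // => z /negbTE ->.
  by rewrite mul0r.
have fE x y : f x y = (y == b)%:R * D x a + (y == a)%:R * D x b +
    ((x == a)%:R * D y b + (x == b)%:R * D y a).
  rewrite /f big_split /=; congr (_ + _).
    rewrite -(pick (D x) a) -(pick (D x) b) !mulr_sumr -big_split.
    by apply: eq_bigr => z _ /=; rewrite Eab; ring.
  rewrite -(pick (D y) a) -(pick (D y) b) !mulr_sumr -big_split.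
  by apply: eq_bigr => z _ /=; rewrite Eab (Dsym z y); ring.
have gE x y : g x y = (x == a)%:R * (y == a)%:R + (x == b)%:R * (y == b)%:R.
  transitivity (\sum_z ((z == b)%:R * ((x == a)%:R * E z y) +
                        (z == a)%:R * ((x == b)%:R * E z y))).
    by apply: eq_bigr => z _; rewrite (Eab x z); ring.
  rewrite big_split /= !pick !Eab !eqxx (eq_sym b a) (negbTE ab).
  by rewrite !mul1r !mul0r add0r addr0; ring.
have k0 : 0 <= k by apply: le_trans (Dk a); apply: sumr_ge0 => y _; exact: sqr_ge0.
have bool2 (i : bool) : (i%:R : R) ^+ 2 = i%:R by case: i; rewrite ?expr1n ?expr0n.
have sqr4 (r1 r2 r3 r4 : R) : (r1 + r2 + (r3 + r4)) ^+ 2 <=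
    4 * (r1 ^+ 2 + r2 ^+ 2 + (r3 ^+ 2 + r4 ^+ 2)).
  have := sqr_ge0 (r1 - r2); have := sqr_ge0 (r3 - r4).
  have := sqr_ge0 (r1 + r2 - (r3 + r4)); lra.
have f2 : \sum_x \sum_y f x y ^+ 2 <= 16 * k.
  pose F x y := 4 * ((y == b)%:R * D x a ^+ 2 + (y == a)%:R * D x b ^+ 2 +
    ((x == a)%:R * D y b ^+ 2 + (x == b)%:R * D y a ^+ 2)).
  apply: (@le_trans _ _ (\sum_x \sum_y F x y)).
    apply: ler_sum => x _; apply: ler_sum => y _; rewrite fE /F.
    by apply: le_trans (sqr4 _ _ _ _) _; rewrite !exprMn !bool2.
  have D1 x0 : \sum_x D x x0 ^+ 2 <= k.
    by under eq_bigr do rewrite Dsym; exact: Dk.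
  rewrite /F; under eq_bigr => x _ do
    rewrite -mulr_sumr !big_split /= !pick -!mulr_sumr.
  rewrite -mulr_sumr !big_split /= !pick.
  have := D1 a; have := D1 b; lra.
have sqr2 (r1 r2 : R) : (r1 + r2) ^+ 2 <= 2 * (r1 ^+ 2 + r2 ^+ 2).
  have := sqr_ge0 (r1 - r2); lra.
have g2 : \sum_x \sum_y g x y ^+ 2 <= 4.
  apply: (@le_trans _ _ (\sum_x \sum_y
      2 * ((x == a)%:R * (y == a)%:R + (x == b)%:R * (y == b)%:R))).
    apply: ler_sum => x _; apply: ler_sum => y _; rewrite gE.
    by apply: le_trans (sqr2 _ _) _; rewrite !exprMn !bool2.
  under eq_bigr => x _ do rewrite -mulr_sumr big_split /= -!mulr_sumr.
  rewrite -mulr_sumr big_split /= !pick.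
  have S1 (x0 : V) : \sum_y (y == x0)%:R = 1 :> R.
    by rewrite -[RHS](pick (fun=> 1) x0); apply: eq_bigr => y _; rewrite mulr1.
  by rewrite !S1; lra.
have cgE : \sum_x \sum_y c x y * g x y = c a a + c b b.
  transitivity (\sum_x ((x == a)%:R * c x a + (x == b)%:R * c x b)).
    apply: eq_bigr => x _; rewrite -(pick (c x) a) -(pick (c x) b).
    by rewrite !mulr_sumr -big_split; apply: eq_bigr => y _ /=; rewrite gE; ring.
  by rewrite big_split /= !pick.
have cxx x : 0 <= c x x <= k.
  apply/andP; split; first by apply: sumr_ge0 => z _; rewrite (Dsym z) -expr2 sqr_ge0.
  by apply: le_trans (Dk x); apply: ler_sum => z _; rewrite (Dsym z) expr2.
have /andP[ca0 cak] := cxx a; have /andP[cb0 cbk] := cxx b.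
have d2 : d ^+ 2 <= 1 by rewrite -real_normK ?num_real // expr_le1.
apply: (@le_trans _ _ (\sum_x \sum_y (c x y ^+ 2 + d * (2 * (c x y * f x y)) +
   (2 * f x y ^+ 2 + 2 * g x y ^+ 2 + d ^+ 2 * 2 * (c x y * g x y))))).
  apply: ler_sum => x _; apply: ler_sum => y _; rewrite D'E.
  have : (d * f x y + d ^+ 2 * g x y) ^+ 2 <= 2 * f x y ^+ 2 + 2 * g x y ^+ 2.
    have h1 : (d * f x y) ^+ 2 <= f x y ^+ 2.
      by rewrite exprMn ler_piMl // sqr_ge0.
    have h2 : (d ^+ 2 * g x y) ^+ 2 <= g x y ^+ 2.
      by rewrite exprMn ler_piMl ?sqr_ge0 // expr_le1 // sqr_ge0.
    have := sqr_ge0 (d * f x y - d ^+ 2 * g x y); lra.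
  lra.
under eq_bigr => x _ do rewrite !big_split /= -!mulr_sumr.
rewrite !big_split /= -!mulr_sumr -/c -/f.
have -> : \sum_x \sum_y c x y ^+ 2 = quad_energy D by [].
have : d ^+ 2 * 2 * (\sum_x \sum_y c x y * g x y) <= 4 * k.
  by rewrite cgE; have := sqr_ge0 d; nra.
lra.
Qed.

Lemma triangle_bound (Q : rel V) :
  (\sum_x \sum_y \sum_z (Q x y && (Q x z && Q y z))%:R) ^+ 2 <=
  (\sum_x \sum_y (Q x y)%:R) ^+ 3 :> R.
Proof.
pose q x y : R := (Q x y)%:R; pose c x y := \sum_z q x z * q y z.
have q2 x y : q x y ^+ 2 = q x y by rewrite /q; case: (Q x y); rewrite ?expr1n ?expr0n.
have q0 x y : 0 <= q x y by exact: ler0n.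
have q1 x y : q x y <= 1 by rewrite lern1 leq_b1.
have -> : \sum_x \sum_y \sum_z (Q x y && (Q x z && Q y z))%:R =
    \sum_(xy : V * V) q xy.1 xy.2 * c xy.1 xy.2.
  rewrite -(pair_big xpredT xpredT (fun x y => q x y * c x y)) /=.
  apply: eq_bigr => x _; apply: eq_bigr => y _; rewrite mulr_sumr.
  by apply: eq_bigr => z _; rewrite -!mulnb !natrM.
apply: le_trans (cauchy_schwarz _ _) _.
rewrite -(pair_big xpredT xpredT (fun x y => q x y ^+ 2)) /=.
rewrite -(pair_big xpredT xpredT (fun x y => c x y ^+ 2)) /=.
set M := \sum_x \sum_y (Q x y)%:R.
have -> : \sum_x \sum_y q x y ^+ 2 = M.
  by apply: eq_bigr => x _; apply: eq_bigr => y _; rewrite q2.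
rewrite exprS; apply: ler_wpM2l.
  by apply: sumr_ge0 => x _; apply: sumr_ge0 => y _; exact: q0.
pose dg x := \sum_z q x z.
rewrite [M ^+ 2]expr2 {1}/M mulr_suml; apply: ler_sum => x _.
rewrite -/(dg x) /M mulr_sumr; apply: ler_sum => y _; rewrite -/(dg y) expr2.
apply: ler_pM; try by apply: sumr_ge0 => z _; rewrite mulr_ge0.
  by apply: ler_sum => z _; rewrite ler_piMr.
by apply: ler_sum => z _; rewrite ler_piMl.
Qed.

End FiniteSums.

(** * Clique counts and the replacement argument *)

Section UpdateAndSupport.
Variables (I V : finType) (v0 : V).
Implicit Types (f g : {ffun I -> V}) (S : {set I}) (Q : rel V).

Definition upd f a x : {ffun I -> V} := [ffun i => if i == a then x else f i].

Lemma updE f a x i : upd f a x i = if i == a then x else f i.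
Proof. by rewrite ffunE. Qed.

(* Functions that are free on [S] and pinned to [v0] elsewhere, so that
   partial sums over some of the coordinates stay sums over one type. *)
Definition pinned S f := [forall i, (i \notin S) ==> (f i == v0)].

Lemma sum_pinned_split (R : nmodType) S a (G : {ffun I -> V} -> R) : a \in S ->
  \sum_(f | pinned S f) G f =
  \sum_(f | pinned (S :\ a) f) \sum_x G (upd f a x).
Proof.
move=> aS; rewrite pair_big_dep.
rewrite (reindex_onto (fun fx : {ffun I -> V} * V => upd fx.1 a fx.2)
  (fun f => (upd f a v0, f a))) /=; last first.
  by move=> f _; apply/ffunP => i; rewrite !updE; case: eqP => [->|].
apply: eq_bigl => -[f x] /=; rewrite andbT; apply/andP/forallP.
  case=> /forallP pf /eqP[<- _] i; apply/implyP => iS; rewrite !updE.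
  have [//|ia] := eqVneq i a; move/implyP: (pf i); rewrite updE (negbTE ia).
  by apply; move: iS; rewrite !inE ia.
move=> pf; split; last first.
  apply/eqP; congr (_, _); last by rewrite updE eqxx.
  apply/ffunP => i; rewrite !updE; have [->|//] := eqVneq i a.
  by have /implyP/(_ _)/eqP -> := pf a; rewrite // !inE eqxx.
apply/forallP => i; apply/implyP => iS; rewrite updE.
have [ia|ia] := eqVneq i a; first by rewrite -ia (negbTE iS) in aS.
by move/implyP: (pf i); apply; rewrite !inE (negbTE iS) andbF.
Qed.

Lemma pinned_setT f : pinned [set: I] f.
Proof. by apply/forallP => i; rewrite inE. Qed.

Definition clique Q S f :=
  [forall i in S, forall j in S, (i != j) ==> Q (f i) (f j)].

Lemma cliqueP Q S f :
  reflect {in S &, forall i j, i != j -> Q (f i) (f j)} (clique Q S f).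
Proof.
apply: (iffP idP) => [/forall_inP h i j iS jS ij|h].
  by move/forall_inP: (h i iS) => /(_ j jS)/implyP; apply.
apply/forall_inP => i iS; apply/forall_inP => j jS; apply/implyP; exact: h.
Qed.

End UpdateAndSupport.

Section CliqueCounts.
Variables (R : realFieldType) (I V : finType) (v0 : V) (Q : rel V).
Implicit Types (f g : {ffun I -> V}) (S : {set I}).

Definition clique_count S : R := \sum_(f | pinned v0 S f) (clique Q S f)%:R.

Definition rel_mass : R := \sum_x \sum_y (Q x y)%:R.

Lemma clique_count_ge0 S : 0 <= clique_count S.
Proof. by apply: sumr_ge0 => f _; exact: ler0n. Qed.

Lemma rel_mass_ge0 : 0 <= rel_mass.
Proof. by apply: sumr_ge0 => x _; apply: sumr_ge0 => y _; exact: ler0n. Qed.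

Lemma clique_count_drop2 S a b : a \in S -> b \in S -> a != b ->
  clique_count S <= rel_mass * clique_count (S :\ a :\ b).
Proof.
move=> aS bS ab; rewrite /clique_count (sum_pinned_split _ _ aS).
rewrite (@sum_pinned_split _ _ _ _ _ b) ?inE ?bS ?andbT; last by rewrite eq_sym.
rewrite mulr_sumr; apply: ler_sum => f _.
rewrite mulr_suml exchange_big; apply: ler_sum => x _ /=.
rewrite mulr_suml; apply: ler_sum => y _; rewrite -natrM mulnb ler_nat.
case: cliqueP => // h; rewrite lt0b; apply/andP; split.
  by have := h a b aS bS ab; rewrite !updE eqxx (eq_sym b) (negbTE ab) eqxx.
apply/cliqueP => i j; rewrite !inE => /and3P[ib ia iS] /and3P[jb ja jS] ij.
have := h i j iS jS ij.
by rewrite !updE (negbTE ia) (negbTE ja) (negbTE ib) (negbTE jb).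
Qed.

Lemma clique_count_drop1 S a (U : pred V) : a \in S ->
  \sum_(f | pinned v0 S f) (clique Q S f && U (f a))%:R <=
  #|U|%:R * clique_count (S :\ a).
Proof.
move=> aS; rewrite /clique_count (sum_pinned_split _ _ aS) mulr_sumr.
apply: ler_sum => f _; rewrite -sum1_card natr_sum mulr_suml.
rewrite [leRHS]big_mkcond /=; apply: ler_sum => x _.
rewrite updE eqxx unfold_in; case: (U x); last by rewrite andbF.
rewrite andbT mul1r ler_nat; case: cliqueP => // h; rewrite lt0b.
apply/cliqueP => i j; rewrite !inE => /andP[ia iS] /andP[ja jS] ij.
by have := h i j iS jS ij; rewrite !updE (negbTE ia) (negbTE ja).
Qed.

Lemma clique_count_set0 : clique_count finset.set0 <= 1.
Proof.
rewrite /clique_count (bigD1 [ffun=> v0]) /=; last first.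
  by apply/forallP => i; rewrite ffunE eqxx implybT.
rewrite big1 ?addr0 ?lern1 ?leq_b1 // => f /andP[/forallP pf /eqP[]].
by apply/ffunP => i; rewrite ffunE; have := pf i; rewrite inE => /eqP.
Qed.

Lemma clique_count3 S : #|S| = 3%N -> clique_count S ^+ 2 <= rel_mass ^+ 3.
Proof.
move=> S3; have /card_gt0P[a aS] : (0 < #|S|)%N by rewrite S3.
have Sa : #|S :\ a| = 2%N by have := cardsD1 a S; rewrite aS S3 => -[].
have /card_gt0P[b bS] : (0 < #|S :\ a|)%N by rewrite Sa.
have Sb : #|S :\ a :\ b| = 1%N by have := cardsD1 b (S :\ a); rewrite bS Sa => -[].
have /card_gt0P[c cS] : (0 < #|S :\ a :\ b|)%N by rewrite Sb.
have Sc : S :\ a :\ b :\ c = finset.set0.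
  apply/eqP; rewrite -cards_eq0; have := cardsD1 c (S :\ a :\ b).
  by rewrite cS Sb add1n => -[<-].
apply: le_trans (triangle_bound R Q).
rewrite ler_pXn2r ?nnegrE ?clique_count_ge0 //; last first.
  by do 3!apply: sumr_ge0 => ? _; exact: ler0n.
rewrite /clique_count (sum_pinned_split _ _ aS) (sum_pinned_split _ _ bS).
rewrite (sum_pinned_split _ _ cS) Sc (bigD1 [ffun=> v0]) /=; last first.
  by apply/forallP => i; rewrite ffunE eqxx implybT.
rewrite [X in _ + X]big1 ?addr0; last first.
  move=> f /andP[/forallP pf /eqP[]].
  by apply/ffunP => i; rewrite ffunE; have := pf i; rewrite inE => /eqP.
rewrite exchange_big (eq_bigr _ (fun y _ => exchange_big _ _ _ _ _ _)) exchange_big.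
apply: ler_sum => x _; apply: ler_sum => y _; apply: ler_sum => z _.
rewrite ler_nat; case: cliqueP => // h; rewrite lt0b.
move: bS cS; rewrite !inE => /andP[ba bS] /and3P[cb ca cS].
have := h a b aS bS; have := h a c aS cS; have := h b c bS cS.
rewrite !updE !eqxx [a == b]eq_sym [a == c]eq_sym [b == c]eq_sym.
by rewrite (negbTE ba) (negbTE ca) (negbTE cb) => -> // -> // ->.
Qed.

Lemma clique_count_sq S : #|S| != 1%N ->
  clique_count S ^+ 2 <= rel_mass ^+ #|S|.
Proof.
move: {2}#|S| (leqnn #|S|) => n; elim: n S => [|n IH] S.
  rewrite leqn0 cards_eq0 => /eqP -> _.
  by rewrite cards0 expr_le1 ?clique_count_set0 ?clique_count_ge0.
move=> Sn S1; have [S3|S3] := eqVneq #|S| 3; first by rewrite S3; exact: clique_count3.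
have [S0|S0] := eqVneq #|S| 0%N; first by apply: IH; rewrite // S0.
have /card_gt0P[a aS] : (0 < #|S|)%N by rewrite lt0n.
have Sa := cardsD1 a S; rewrite aS add1n in Sa.
have /card_gt0P[b bS] : (0 < #|S :\ a|)%N.
  by rewrite lt0n; apply: contra S1 => /eqP E; rewrite Sa E.
have Sb := cardsD1 b (S :\ a); rewrite bS add1n in Sb.
have ab : a != b by move: bS; rewrite !inE eq_sym => /andP[].
have bS' : b \in S by move: bS; rewrite inE => /andP[].
apply: (@le_trans _ _ ((rel_mass * clique_count (S :\ a :\ b)) ^+ 2)).
  rewrite ler_pXn2r ?nnegrE ?clique_count_ge0 ?mulr_ge0 ?rel_mass_ge0 ?clique_count_ge0 //.
  exact: clique_count_drop2.
rewrite exprMn Sa Sb (exprD _ 2 #|_|); apply: ler_wpM2l; first exact: sqr_ge0.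
apply: IH; first by rewrite Sa Sb in Sn; rewrite -ltnS ltnW.
by apply: contra S3 => /eqP E; rewrite Sa Sb E.
Qed.

End CliqueCounts.

Section Counting.
Variables (R : realFieldType) (m : nat) (V : finType) (v0 : V) (Q B : rel V).
Hypotheses (Qsym : symmetric Q) (Bsym : symmetric B) (BQ : subrel B Q).
Variables (p lam K : R).
Hypotheses (p0 : 0 <= p) (p1 : p <= 1) (lam0 : 0 < lam).
Hypothesis count_le :
  forall S : {set 'I_m}, #|S| = m.-1 -> clique_count R v0 Q S <= K.
Implicit Types (f g : {ffun 'I_m -> V}) (e : 'I_m * 'I_m) (k : 'I_m * 'I_m -> rel V).

Definition defect x y : R := (B x y)%:R - p * (Q x y)%:R.

Lemma defectC x y : defect x y = defect y x.
Proof. by rewrite /defect Qsym Bsym. Qed.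

Definition edges_in k (P : pred ('I_m * 'I_m)) f :=
  [forall e : 'I_m * 'I_m, (e.1 < e.2)%N && P e ==> k e (f e.1) (f e.2)].

Lemma edges_inP k (P : pred ('I_m * 'I_m)) f :
  reflect (forall e, (e.1 < e.2)%N -> P e -> k e (f e.1) (f e.2))
    (edges_in k P f).
Proof.
apply: (iffP forallP) => h e; first by move=> e12 Pe; move/implyP: (h e); apply; rewrite e12.
by apply/implyP => /andP[]; exact: h.
Qed.

Lemma eq_edges_in k (P : pred ('I_m * 'I_m)) f g :
  (forall e, (e.1 < e.2)%N -> P e -> f e.1 = g e.1 /\ f e.2 = g e.2) ->
  edges_in k P f = edges_in k P g.
Proof.
by move=> h; apply/edges_inP/edges_inP => H e e12 Pe;
   have [E1 E2] := h e e12 Pe; have := H e e12 Pe; rewrite E1 E2.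
Qed.

Lemma edges_in_clique k a f : (forall e, subrel (k e) Q) ->
  edges_in k [pred e | (e.1 != a) && (e.2 != a)] f ->
  clique Q ([set: 'I_m] :\ a) f.
Proof.
move=> kQ /edges_inP h; apply/cliqueP => i j; rewrite !inE !andbT => ia ja ij.
have [lij|lji] := ltnP i j; first by apply: (kQ (i, j)); apply: h; rewrite //= ia.
rewrite Qsym; apply: (kQ (j, i)); apply: h; rewrite //= ?ia ?ja //.
by rewrite ltn_neqAle lji andbT eq_sym.
Qed.

Lemma step_bound k (a b : 'I_m) : (a < b)%N -> (forall e, subrel (k e) Q) ->
  `|\sum_(f : {ffun 'I_m -> V}) defect (f a) (f b) * (edges_in k (predC1 (a, b)) f)%:R| <=
  (lam + quad_energy defect / lam ^+ 3) * K.
Proof.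
move=> ab kQ; set T := lam + _.
have T0 : 0 <= T.
  apply: addr_ge0; first exact: ltW.
  by apply: divr_ge0; rewrite ?quad_energy_ge0 // ltW // exprn_gt0.
have nab : a != b by rewrite neq_ltn ab.
have nba : b != a by rewrite eq_sym.
pose Pu : pred ('I_m * 'I_m) :=
  [pred e | ((e.1 == a) || (e.2 == a)) && ((e.1 != b) && (e.2 != b))].
pose Pv : pred ('I_m * 'I_m) :=
  [pred e | ((e.1 == b) || (e.2 == b)) && ((e.1 != a) && (e.2 != a))].
pose Ph : pred ('I_m * 'I_m) :=
  [pred e | ((e.1 != a) && (e.2 != a)) && ((e.1 != b) && (e.2 != b))].
pose h f := edges_in k Ph f; pose u f := edges_in k Pu f; pose v f := edges_in k Pv f.
have split3 f : edges_in k (predC1 (a, b)) f = [&& h f, u f & v f].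
  apply/edges_inP/and3P => [H|[/edges_inP Hh /edges_inP Hu /edges_inP Hv] [i j] /= ij Pe].
    split; apply/edges_inP => -[i j] /= ij Pe; apply: H => //=.
    - by apply/eqP => -[Ei Ej]; move: Pe; rewrite Ei Ej /Ph /= eqxx.
    - by apply/eqP => -[Ei Ej]; move: Pe; rewrite Ei Ej /Pu /= !eqxx !andbF.
    - by apply/eqP => -[Ei Ej]; move: Pe; rewrite Ei Ej /Pv /= !eqxx !andbF.
  have [Eia|nia] := eqVneq i a; last have [Eja|nja] := eqVneq j a.
  - apply: (Hu (i, j)) => //; rewrite /Pu /= Eia eqxx nab /=.
    by apply: contraNneq Pe => ->; rewrite Eia.
  - apply: (Hu (i, j)) => //; rewrite /Pu /= Eja eqxx nab orbT andbT /=.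
    by apply: contraTneq ij => ->; rewrite Eja -leqNgt ltnW.
  have [ib|nib] := boolP ((i == b) || (j == b)).
    by apply: (Hv (i, j)); rewrite // /Pv /= ib nia nja.
  by apply: (Hh (i, j)); rewrite // /Ph /= nia nja /= -negb_or.
have hupd f x y : h (upd (upd f b y) a x) = h f.
  apply: eq_edges_in => -[i j] /= _ /andP[/andP[ia ja] /andP[ib jb]].
  by rewrite !updE (negbTE ia) (negbTE ja) (negbTE ib) (negbTE jb).
have hupda f x : h (upd f a x) = h f.
  apply: eq_edges_in => -[i j] /= _ /andP[/andP[ia ja] _].
  by rewrite !updE (negbTE ia) (negbTE ja).
have hupdb f x : h (upd f b x) = h f.
  apply: eq_edges_in => -[i j] /= _ /andP[_ /andP[ia ja]].
  by rewrite !updE (negbTE ia) (negbTE ja).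
have uupd f x y : u (upd (upd f b y) a x) = u (upd f a x).
  apply: eq_edges_in => -[i j] /= _ /andP[_ /andP[ib jb]].
  by rewrite !updE (negbTE ib) (negbTE jb).
have vupd f x y : v (upd (upd f b y) a x) = v (upd f b y).
  apply: eq_edges_in => -[i j] /= _ /andP[_ /andP[ia ja]].
  by rewrite !updE (negbTE ia) (negbTE ja).
have bT : b \in [set: 'I_m] :\ a by rewrite !inE nba.
have aT : a \in [set: 'I_m] :\ b by rewrite !inE nab.
have sumT (G : {ffun 'I_m -> V} -> R) :
    \sum_f G f = \sum_(f | pinned v0 [set: 'I_m] f) G f.
  by apply: eq_bigl => f; rewrite pinned_setT.
have CT c : #|[set: 'I_m] :\ c| = m.-1.
  have := cardsD1 c [set: 'I_m]; rewrite inE cardsT card_ord add1n.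
  by move/(congr1 predn) => /= <-.
pose S2 := [set: 'I_m] :\ a :\ b.
have uK : \sum_(f | pinned v0 S2 f) \sum_x (h f && u (upd f a x))%:R <= K.
  apply: le_trans (count_le (CT b)).
  rewrite /clique_count (sum_pinned_split _ _ aT).
  have -> : [set: 'I_m] :\ b :\ a = S2 by apply/finset.setP => i; rewrite !inE !andbT andbC.
  apply: ler_sum => f _; apply: ler_sum => x _; rewrite ler_nat -(hupda f x).
  case: andP => // -[/edges_inP H1 /edges_inP H2]; rewrite lt0b.
  apply: (edges_in_clique kQ); apply/edges_inP => e e12 /andP[e1b e2b].
  have [ea|ea] := boolP ((e.1 == a) || (e.2 == a)).
    by apply: H2; rewrite // /Pu /= ea e1b e2b.
  by apply: H1; rewrite // /Ph /= e1b e2b -negb_or ea.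
have vK : \sum_(f | pinned v0 S2 f) \sum_x (h f && v (upd f b x))%:R <= K.
  apply: le_trans (count_le (CT a)).
  rewrite /clique_count (sum_pinned_split _ _ bT).
  apply: ler_sum => f _; apply: ler_sum => x _; rewrite ler_nat -(hupdb f x).
  case: andP => // -[/edges_inP H1 /edges_inP H2]; rewrite lt0b.
  apply: (edges_in_clique kQ); apply/edges_inP => e e12 /andP[e1a e2a].
  have [eb|eb] := boolP ((e.1 == b) || (e.2 == b)).
    by apply: H2; rewrite // /Pv /= eb e1a e2a.
  by apply: H1; rewrite // /Ph /= e1a e2a -negb_or eb.
rewrite sumT (@sum_pinned_split _ _ _ _ _ a) ?inE // (sum_pinned_split _ _ bT) -/S2.
have b2 (c : bool) : (c%:R : R) ^+ 2 = c%:R by case: c; rewrite ?expr1n ?expr0n.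
apply: (@le_trans _ _ (\sum_(f | pinned v0 S2 f) T *
   ((\sum_x (h f && u (upd f a x))%:R + \sum_y (h f && v (upd f b y))%:R) / 2))).
  apply: le_trans (ler_norm_sum _ _ _) _; apply: ler_sum => f _.
  have sq (c : V -> bool) : \sum_x (c x)%:R = \sum_x (c x)%:R ^+ 2 :> R.
    by apply: eq_bigr => x _; rewrite b2.
  rewrite (sq (fun x => h f && u (upd f a x))) (sq (fun x => h f && v (upd f b x))).
  apply: le_trans _ (bilinear_le _ _ defectC lam0); rewrite exchange_big /=.
  rewrite le_eqVlt; apply/orP; left; apply/eqP; congr `|_|.
  apply: eq_bigr => x _; apply: eq_bigr => y _.
  rewrite !updE eqxx (negbTE nba) eqxx split3 hupd uupd vupd -natrM mulnb.
  by congr (_ * _%:R); case: (h f) => //=; case: (u _).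
rewrite -mulr_sumr -mulr_suml big_split /=; apply: ler_wpM2l => //; lra.
Qed.

Lemma counting :
  `|\sum_f (clique B [set: 'I_m] f)%:R - p ^+ 'C(m, 2) * \sum_f (clique Q [set: 'I_m] f)%:R|
  <= 'C(m, 2)%:R * ((lam + quad_energy defect / lam ^+ 3) * K).
Proof.
set T := _ * K.
pose k (A : {set 'I_m * 'I_m}) e := if e \in A then Q else B.
pose F A f : R := (edges_in (k A) predT f)%:R.
pose E : {set 'I_m * 'I_m} := [set e : 'I_m * 'I_m | (e.1 < e.2)%N].
have kQ A e : subrel (k A e) Q by move=> x y; rewrite /k; case: ifP => // _; exact: BQ.
have H (A : {set 'I_m * 'I_m}) : A \subset E ->
    `|\sum_f F finset.set0 f - p ^+ #|A| * \sum_f F A f| <= #|A|%:R * T.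
  move: {2}#|A| (erefl #|A|) => n; elim: n A => [|n IH] A.
    by move=> /eqP; rewrite cards_eq0 => /eqP ->; rewrite cards0 mul1r subrr normr0 mul0r.
  move=> An AE; have /card_gt0P[e eA] : (0 < #|A|)%N by rewrite An.
  have A'n : #|A :\ e| = n by have := cardsD1 e A; rewrite eA An => -[].
  have {}IH := IH _ A'n (fintype.subset_trans (finset.subsetDl _ _) AE).
  rewrite A'n in IH; rewrite An.
  have -> : \sum_f F finset.set0 f - p ^+ n.+1 * \sum_f F A f =
      (\sum_f F finset.set0 f - p ^+ n * \sum_f F (A :\ e) f) +
      p ^+ n * (\sum_f F (A :\ e) f - p * \sum_f F A f) by rewrite exprS; ring.
  apply: le_trans (ler_normD _ _) _; rewrite -natr1 mulrDl mul1r.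
  apply: lerD => //; rewrite normrM ger0_norm ?exprn_ge0 //.
  have eE : (e.1 < e.2)%N by move/fintype.subsetP: AE => /(_ e eA); rewrite inE.
  apply: le_trans (_ : `|\sum_f F (A :\ e) f - p * \sum_f F A f| <= _).
    by rewrite ler_piMl // exprn_ile1.
  rewrite mulr_sumr -sumrB.
  have := step_bound eE (kQ (A :\ e)); apply: le_trans.
  rewrite le_eqVlt; apply/orP; left; apply/eqP; congr `|_|.
  have FE (A' : {set 'I_m * 'I_m}) f : A' :\ e = A :\ e ->
     F A' f = (k A' e (f e.1) (f e.2))%:R *
      (edges_in (k (A :\ e)) (predC1 (e.1, e.2)) f)%:R.
    move=> A'A; rewrite -natrM mulnb /F; congr (nat_of_bool _)%:R.
    have kk e' : e' != e -> k A' e' = k (A :\ e) e'.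
      by move=> e'e; rewrite /k -A'A !inE e'e.
    rewrite -surjective_pairing; apply/edges_inP/andP.
      move=> h; split; first by apply: h.
      by apply/edges_inP => e' e'12 /= e'e; rewrite -kk //; apply: h.
    move=> [h1 /edges_inP h2] e' e'12 _.
    by have [->//|e'e] := eqVneq e' e; rewrite kk //; apply: h2.
  apply: eq_bigr => f _; rewrite (FE (A :\ e)) ?(FE A) //; last first.
    by apply/finset.setP => e'; rewrite !inE; case: eqP.
  by rewrite /k !inE eqxx eA /= /defect; ring.
have {H} := H E (subxx _).
have -> : #|E| = 'C(m, 2).
  rewrite -bin2_sum big_mkord -sum1dep_card.
  rewrite -(pair_big_dep xpredT (fun i j : 'I_m => (i < j)%N) (fun _ _ => 1%N)) /=.
  rewrite (exchange_big_dep xpredT) //=; apply: eq_bigr => j _.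
  by rewrite (big_ord_narrow (ltnW (ltn_ord j))) sum1_card card_ord.
have FE (A : {set 'I_m * 'I_m}) (C : rel V) f : symmetric C ->
    (forall e, (e.1 < e.2)%N -> k A e = C) ->
    F A f = (clique C [set: 'I_m] f)%:R.
  move=> Csym kC; congr (nat_of_bool _)%:R; apply/edges_inP/cliqueP => [h i j _ _ ij|h e e12 _].
    have [lij|lji] := ltnP i j; first by rewrite -(kC (i, j)) //; apply: h.
    have {}lji : (j < i)%N by rewrite ltn_neqAle lji andbT eq_sym.
    by rewrite Csym -(kC (j, i)) //; apply: h.
  by rewrite kC //; apply: h; rewrite ?inE // neq_ltn e12.
have FB f : F finset.set0 f = (clique B [set: 'I_m] f)%:R.
  by apply: FE => // e _; rewrite /k inE.
have FQ f : F E f = (clique Q [set: 'I_m] f)%:R.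
  by apply: FE => // e ee; rewrite /k inE ee.
by rewrite (eq_bigr _ (fun f _ => FB f)) (eq_bigr _ (fun f _ => FQ f)).
Qed.

End Counting.

(** * Averages over the answers *)

Lemma sum_clique2 (R : realFieldType) (V : finType) (v0 : V) (Q : rel V) :
  symmetric Q ->
  \sum_(f : {ffun 'I_2 -> V}) (clique Q [set: 'I_2] f)%:R = rel_mass R Q.
Proof.
move=> Qsym; pose i0 : 'I_2 := ord0; pose i1 : 'I_2 := ord_max.
have I2 (i : 'I_2) : i = i0 \/ i = i1.
  by case: i => [[|[|//]] ?]; [left|right]; apply: val_inj.
rewrite (eq_bigl (pinned v0 [set: 'I_2])); last by move=> f; rewrite pinned_setT.
rewrite (@sum_pinned_split _ _ _ _ _ i0) ?inE //.
rewrite (@sum_pinned_split _ _ _ _ _ i1) ?inE //.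
rewrite (bigD1 [ffun=> v0]) /=; last first.
  by apply/forallP => i; rewrite ffunE eqxx implybT.
rewrite [X in _ + X]big1 ?addr0; last first.
  move=> f /andP[/forallP pf /eqP[]].
  apply/ffunP => i; rewrite ffunE; have := pf i; rewrite !inE andbT.
  by have [->|->] := I2 i; rewrite eqxx ?andbF /= => /eqP.
rewrite exchange_big; apply: eq_bigr => x _; apply: eq_bigr => y _.
congr (nat_of_bool _)%:R; apply/cliqueP/idP => [h|Qxy i j _ _ ij].
  by have := h i0 i1; rewrite !inE !updE /=; apply.
by move: ij; have [->|->] := I2 i; have [->|->] := I2 j; rewrite ?eqxx // => _;
  rewrite !updE /= // Qsym.
Qed.

Section Mean.
Variables (R : realFieldType) (p : R).
Hypotheses (p0 : 0 <= p) (p1 : p <= 1).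
Implicit Types (n : nat) (X Y : seq bool -> R).

Definition mean n X : R :=
  \sum_(w : n.-tuple bool) (\prod_(b <- w) (if b then p else 1 - p)) * X w.

Lemma meanS n X :
  mean n.+1 X = mean n (fun w => p * X (rcons w true) + (1 - p) * X (rcons w false)).
Proof.
pose h (wb : n.-tuple bool * bool) : n.+1.-tuple bool := [tuple of rcons wb.1 wb.2].
have hbij : bijective h.
  apply: inj_card_bij; last by rewrite card_prod !card_tuple card_bool expnSr.
  move=> [w b] [w' b'] /(congr1 val) /= /rcons_inj[E ->].
  by congr (_, _); apply: val_inj.
rewrite /mean (reindex h) /=; last exact: onW_bij.
rewrite -(pair_big xpredT xpredT (fun w b =>
  (\prod_(c <- rcons (tval w) b) (if c then p else 1 - p)) * X (rcons w b))) /=.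
apply: eq_bigr => w _; rewrite big_bool /= !big_rcons /=; ring.
Qed.

Lemma mean0 X : mean 0 X = X [::].
Proof.
rewrite /mean (bigD1 [tuple]) //= big_nil mul1r big1 ?addr0 // => w /eqP[].
exact: tuple0.
Qed.

Lemma weight_ge0 n (w : n.-tuple bool) : 0 <= \prod_(b <- w) (if b then p else 1 - p).
Proof. by apply: prodr_ge0 => -[]; rewrite ?subr_ge0. Qed.

Lemma le_mean n X Y : (forall w, size w = n -> X w <= Y w) -> mean n X <= mean n Y.
Proof.
move=> XY; apply: ler_sum => w _; apply: ler_wpM2l; first exact: weight_ge0.
by apply: XY; rewrite size_tuple.
Qed.

Lemma eq_mean n X Y : (forall w, size w = n -> X w = Y w) -> mean n X = mean n Y.
Proof. by move=> XY; apply: eq_bigr => w _; rewrite XY // size_tuple. Qed.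

Lemma meanD n X Y : mean n (fun w => X w + Y w) = mean n X + mean n Y.
Proof. by rewrite -big_split; apply: eq_bigr => w _; rewrite /= mulrDr. Qed.

Lemma meanZ n a X : mean n (fun w => a * X w) = a * mean n X.
Proof. by rewrite mulr_sumr; apply: eq_bigr => w _; rewrite mulrCA. Qed.

Lemma meanB n X Y : mean n (fun w => X w - Y w) = mean n X - mean n Y.
Proof. by rewrite -sumrB; apply: eq_bigr => w _; rewrite /= mulrBr. Qed.

Lemma mean_cst n a : mean n (fun=> a) = a.
Proof.
elim: n => [|n IH]; first by rewrite mean0.
by rewrite meanS -[RHS]IH; apply: eq_mean => w _; ring.
Qed.

Lemma mean_norm n X : `|mean n X| <= mean n (fun w => `|X w|).
Proof.
apply: le_trans (ler_norm_sum _ _ _) _; apply: ler_sum => w _.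
by rewrite normrM ger0_norm // weight_ge0.
Qed.

(* The term linear in [b - p] averages out, so it may depend on the past. *)
Lemma mean_increment_le n X (k : R) :
  (forall w, (size w < n)%N ->
    exists z, forall b, X (rcons w b) <= X w + (b%:R - p) * z + k) ->
  X [::] <= 0 -> mean n X <= n%:R * k.
Proof.
move=> h X0; have H j : (j <= n)%N -> mean j X <= j%:R * k.
  elim: j => [|j IH] jn; first by rewrite mean0 mul0r.
  apply: (@le_trans _ _ (mean j X + mean j (fun=> k))); last first.
    by rewrite mean_cst -natr1 mulrDl mul1r lerD2r IH // ltnW.
  rewrite meanS -meanD.
  apply: le_mean => w wj; rewrite -wj in jn.
  have [z {}h] := h w jn; have := ler_wpM2l p0 (h true).
  have := ler_wpM2l (_ : 0 <= 1 - p) (h false); rewrite subr_ge0 => /(_ p1).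
  rewrite /=; nra.
exact: H.
Qed.

End Mean.

(** * Light and heavy queries *)

Section Edges.
Variable V : {fset int}.
Implicit Types (x y : V) (E : seq pair_of_vertices) (e : pair_of_vertices).

Definition edge x y : pair_of_vertices := [fset val x; val y]%fset.

Definition edge_rel E : rel V := fun x y => edge x y \in E.

Lemma edgeC x y : edge x y = edge y x.
Proof. by apply/fsetP => z; rewrite !inE orbC. Qed.

Lemma edge_rel_sym E : symmetric (edge_rel E).
Proof. by move=> x y; rewrite /edge_rel edgeC. Qed.

Lemma edge_eq a b x y :
  (edge x y == edge a b) = (x == a) && (y == b) || (x == b) && (y == a).
Proof.
apply/eqP/orP => [/fsetP E|[]/andP[/eqP-> /eqP->] //]; last exact: edgeC.
have := E (val x); have := E (val y); have := E (val a); have := E (val b).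
rewrite !inE !val_eqE !eqxx ?orbT /=.
rewrite [b == x]eq_sym [b == y]eq_sym [a == x]eq_sym [a == y]eq_sym.
have [xa|xa] := eqVneq x a; have [yb|yb] := eqVneq y b;
  have [xb|xb] := eqVneq x b; have [ya|ya] := eqVneq y a; rewrite /= ?andbF; auto.
Qed.

Lemma edge_surj e : #|` e| = 2%N -> (e `<=` V)%fset ->
  exists2 ab : V * V, ab.1 != ab.2 & e = edge ab.1 ab.2.
Proof.
move=> e2 /fsubsetP eV; have /fset0Pn[a ae] : e != fset0 by rewrite -cardfs_gt0 e2.
have E1 : #|` (e `\ a)%fset| = 1%N by have := cardfsD1 a e; rewrite ae e2 => -[].
have /fset0Pn[b bea] : (e `\ a)%fset != fset0 by rewrite -cardfs_gt0 E1.
have be : b \in e by move: bea; rewrite !inE => /andP[].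
exists ([` eV a ae]%fset, [` eV b be]%fset).
  by rewrite -val_eqE /= eq_sym; move: bea; rewrite !inE => /andP[].
rewrite /edge /=; apply/esym/eqP; rewrite eqEfcard cardfs2 e2.
have -> : a != b by move: bea; rewrite !inE eq_sym => /andP[].
rewrite andbT; apply/fsubsetP => z; rewrite !inE => /orP[]/eqP -> //.
Qed.

Variable R : realFieldType.

Lemma edge_degree E x :
  \sum_y (edge_rel E x y)%:R <= (count (fun e => val x \in e) E)%:R :> R.
Proof.
elim: E => [|e E IH]; first by rewrite big1.
rewrite /= natrD; apply: le_trans (lerD (lexx _) IH).
apply: (@le_trans _ _ (\sum_y (edge x y == e)%:R + \sum_y (edge_rel E x y)%:R)).
  rewrite -big_split; apply: ler_sum => y _ /=; rewrite /edge_rel inE -natrD ler_nat.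
  by case: (_ == _); case: (_ \in _).
rewrite lerD2r; have [xe|xe] := boolP (val x \in e); last first.
  rewrite big1 // => y _; case: eqP => // Exy; case/negP: xe.
  by rewrite -Exy !inE eqxx.
have [[y0 /eqP Ey0]|no] := pselect (exists y0, edge x y0 == e); last first.
  by rewrite big1 // => y _; case: eqP => // Exy; case: no; exists y; apply/eqP.
rewrite (bigD1 y0) //= Ey0 eqxx big1 ?addr0 // => y yy0.
rewrite -Ey0 edge_eq eqxx (negbTE yy0) /=.
by case: andP => // -[/eqP xy0 /eqP yx]; rewrite yx xy0 eqxx in yy0.
Qed.

Lemma sum_degree E : (forall e, e \in E -> #|` e| = 2%N) ->
  (\sum_(x : V) count (fun e => val x \in e) E <= 2 * size E)%N.
Proof.
elim: E => [|e E IH] E2; first by rewrite big1.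
rewrite /= big_split /= mulnS; apply: leq_add; last first.
  by apply: IH => e' e'E; apply: E2; rewrite inE e'E orbT.
have -> : (\sum_(x : V) (val x \in e) = #|[pred x : V | val x \in e]|)%N.
  by rewrite -sum1_card [RHS]big_mkcond; apply: eq_bigr => x _; rewrite inE; case: ifP.
rewrite -(E2 e (mem_head _ _)) cardE -(size_map val).
apply: uniq_leq_size; first by rewrite map_inj_uniq ?enum_uniq //; exact: val_inj.
by move=> z /mapP[x]; rewrite mem_enum inE => xe ->.
Qed.

Lemma edge_mass E : (forall e, e \in E -> #|` e| = 2%N) ->
  rel_mass R (edge_rel E) <= (2 * size E)%:R.
Proof.
move=> E2; apply: le_trans (_ : (\sum_(x : V) count (fun e => val x \in e) E)%:R <= _).
  by rewrite natr_sum; apply: ler_sum => x _; exact: edge_degree.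
by rewrite ler_nat sum_degree.
Qed.

End Edges.

Section Copies.
Variables (m : nat) (V : {fset int}) (E : seq pair_of_vertices).
Hypotheses (m2 : (2 <= m)%N) (E2 : forall e, e \in E -> #|` e| = 2%N).
Hypothesis EV : forall e, e \in E -> (e `<=` V)%fset.

Lemma num_copies_clique : num_copies (@complete_graph m) E =
  #|[pred f : {ffun 'I_m -> V} | clique (edge_rel E) [set: 'I_m] f]|.
Proof.
have noH := complete_graph_no_isolated m2; have fin := finite_copies E noH.
pose F := fun g : {ffun 'I_m -> V} => [ffun v => val (g v)] : {ffun 'I_m -> int}.
have Finj : injective F.
  move=> g h /ffunP gh; apply/ffunP => i; have := gh i; rewrite !ffunE; exact: val_inj.
rewrite cardE -(size_map F) /num_copies; apply/eqP; rewrite eqn_leq.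
apply/andP; split; apply: uniq_leq_size; first exact: fset_uniq.
- move=> f; rewrite in_fset_set // inE /= => -[finj fE].
  have fV v : f v \in V.
    have [u vu] := noH v; apply: (fsubsetP (EV (fE _ _ vu))).
    by rewrite !inE eqxx.
  apply/mapP; exists [ffun v => [` fV v]%fset]; last by apply/ffunP => v; rewrite !ffunE.
  rewrite mem_enum inE; apply/cliqueP => i j _ _ ij.
  by rewrite !ffunE /edge_rel /edge /=; apply: fE.
- by rewrite map_inj_uniq ?enum_uniq.
- move=> f /mapP[g]; rewrite mem_enum inE => /cliqueP gc ->.
  rewrite in_fset_set // inE; split => [i j|i j ij]; last first.
    by rewrite !ffunE; apply: gc; rewrite ?inE.
  rewrite !ffunE => /val_inj gij; apply/eqP/negPn/negP => ij.
  have /E2 : edge (g i) (g j) \in E by apply: gc; rewrite ?inE.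
  by rewrite /edge gij fsetUid cardfs1.
Qed.

End Copies.

Section Game.
Variables (N : nat) (s : strategy).
Hypothesis ls : legal N s.

Lemma queries_rcons w b : queries s (rcons w b) = rcons (queries s w) (s w).
Proof.
rewrite /queries size_rcons -addn1 iotaD map_cat /= add0n -cats1 -[RHS]cats1.
rewrite take_size_cat //; congr (_ ++ _).
by apply/eq_in_map => i; rewrite mem_iota => /andP[_ iw]; rewrite takel_cat // ltnW.
Qed.

Lemma size_queries w : size (queries s w) = size w.
Proof. by rewrite size_map size_iota. Qed.

Lemma built_rcons w b :
  built s (rcons w b) = if b then rcons (built s w) (s w) else built s w.
Proof.
rewrite /built queries_rcons -!cats1 mask_cat ?size_queries //.
by case: b => //=; rewrite cats0.
Qed.

Lemma legal_prefix w : (size w <= N)%N ->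
  uniq (queries s w) /\ forall e, e \in queries s w -> #|` e| = 2%N.
Proof.
move: {2}(N - size w)%N (erefl (N - size w)%N) => d; elim: d w => [|d IH] w Nw wN.
  have wN' : size w == N by rewrite eqn_leq wN -subn_eq0 Nw.
  exact: (ls (Tuple wN')).
have [||] := IH (rcons w true).
- by rewrite size_rcons subnS Nw.
- by rewrite size_rcons -subn_gt0 Nw.
rewrite queries_rcons rcons_uniq => /andP[_ u] h; split => // e ew.
by apply: h; rewrite mem_rcons inE ew orbT.
Qed.

Lemma legal_next w : (size w < N)%N -> s w \notin queries s w /\ #|` s w| = 2%N.
Proof.
rewrite -(size_rcons w true) => /legal_prefix; rewrite queries_rcons rcons_uniq.
by case=> /andP[nw _] h; split => //; apply: h; rewrite mem_rcons mem_head.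
Qed.

Definition vertices : {fset int} :=
  (\bigcup_(w <- enum {: N.-tuple bool}) \bigcup_(e <- queries s w) e)%fset.

Lemma queries_vertices w e : (size w <= N)%N -> e \in queries s w ->
  (e `<=` vertices)%fset.
Proof.
move: {2}(N - size w)%N (erefl (N - size w)%N) => d; elim: d w => [|d IH] w Nw wN ew.
  have wN' : size w == N by rewrite eqn_leq wN -subn_eq0 Nw.
  apply/fsubsetP => x xe; apply/bigfcupP; exists (Tuple wN'); first by rewrite mem_enum.
  by apply/bigfcupP; exists e; rewrite ?ew.
apply: (IH (rcons w true)).
- by rewrite size_rcons subnS Nw.
- by rewrite size_rcons -subn_gt0 Nw.
- by rewrite queries_rcons mem_rcons inE ew orbT.
Qed.

Section Light.
Variable D : nat.

Definition degree (w : seq bool) (x : int) : nat :=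
  count (fun e : pair_of_vertices => x \in e) (queries s w).

Definition light w := all (fun x => degree w x < D)%N (s w).

Definition light_queries w :=
  [seq s (take i w) | i <- iota 0 (size w) & light (take i w)].

Definition light_built w := [seq e <- light_queries w | e \in built s w].

Lemma light_queries_rcons w b : light_queries (rcons w b) =
  if light w then rcons (light_queries w) (s w) else light_queries w.
Proof.
rewrite /light_queries size_rcons -addn1 iotaD filter_cat map_cat /= add0n.
have tkw : take (size w) (rcons w b) = w by rewrite -cats1 take_size_cat.
rewrite tkw.
have tk i : i \in iota 0 (size w) -> take i (rcons w b) = take i w.
  by rewrite mem_iota => /andP[_ iw]; rewrite -cats1 takel_cat // ltnW.
have -> : [seq i <- iota 0 (size w) | light (take i (rcons w b))] =
    [seq i <- iota 0 (size w) | light (take i w)].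
  by apply: eq_in_filter => i /tk ->.
have -> : [seq s (take i (rcons w b)) | i <- iota 0 (size w) & light (take i w)] =
    [seq s (take i w) | i <- iota 0 (size w) & light (take i w)].
  by apply/eq_in_map => i; rewrite mem_filter => /andP[_ /tk ->].
by case: ifP => _ /=; rewrite ?cats0 ?tkw ?cats1.
Qed.

Lemma light_subset w : {subset light_queries w <= queries s w}.
Proof.
move=> e /mapP[i]; rewrite mem_filter => /andP[_ iw] ->.
by apply/mapP; exists i.
Qed.

Lemma built_subset w : {subset built s w <= queries s w}.
Proof. by move=> e /mem_mask. Qed.

Lemma size_light w : (size (light_queries w) <= size w)%N.
Proof. by rewrite size_map size_filter (leq_trans (count_size _ _)) // size_iota. Qed.

Lemma light_degree w x :
  (count (fun e : pair_of_vertices => x \in e) (light_queries w) <= D)%N.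
Proof.
have H w' : (count (fun e : pair_of_vertices => x \in e) (light_queries w') <= degree w' x)%N.
  elim/last_ind: w' => [|w' b IH] //; rewrite /degree queries_rcons light_queries_rcons.
  rewrite -[rcons (queries _ _) _]cats1 count_cat.
  case: ifP => _; last by apply: leq_trans IH (leq_addr _ _).
  by rewrite -cats1 count_cat leq_add2r.
elim/last_ind: w => [|w b IH] //; rewrite light_queries_rcons.
case: ifP => // /allP lw; rewrite -cats1 count_cat /= addn0.
have [xs|_] := boolP (x \in s w); last by rewrite addn0.
by rewrite addn1; apply: leq_ltn_trans (H w) (lw _ xs).
Qed.

Lemma degree_rcons w b x : (degree w x <= degree (rcons w b) x)%N.
Proof. by rewrite /degree queries_rcons -cats1 count_cat leq_addr. Qed.

Lemma heavy_query w e : e \in queries s w -> e \notin light_queries w ->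
  exists2 x, x \in e & (D <= degree w x)%N.
Proof.
elim/last_ind: w => [|w b IH] //.
rewrite queries_rcons light_queries_rcons mem_rcons inE => /orP[/eqP ->|ew].
  case: ifP => [_|/negbT /allPn[x xs]]; first by rewrite mem_rcons mem_head.
  by rewrite -leqNgt => Dx _; exists x => //; apply: leq_trans Dx (degree_rcons _ _ _).
move=> nl; have [|x xe Dx] := IH ew; last first.
  by exists x => //; apply: leq_trans Dx (degree_rcons _ _ _).
apply: contra nl => el; case: ifP => // _; by rewrite mem_rcons inE el orbT.
Qed.

End Light.

End Game.

Section CopiesOnAverage.
Variables (R : realType) (p : R) (N : nat) (s : strategy) (D : nat).
Hypotheses (p0 : 0 <= p) (p1 : p <= 1) (ls : legal N s).

Let V := vertices N s.
Let Q w : rel V := @edge_rel V (light_queries s D w).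
Let B w : rel V := @edge_rel V (light_built s D w).
Let Qall w : rel V := @edge_rel V (queries s w).
Let Ball w : rel V := @edge_rel V (built s w).
Let dft w := defect (Q w) (B w) p.
Let rt : R := Num.sqrt (2 * N%:R).

Lemma light_built_sub w : subrel (B w) (Q w).
Proof. by move=> x y; rewrite /B /edge_rel mem_filter => /andP[]. Qed.

Lemma defect_rcons w : (size w < N)%N ->
  exists a b : V, a != b /\ forall c x y,
    dft (rcons w c) x y =
    dft w x y + (if light s D w then c%:R - p else 0) * edge_ind R a b x y.
Proof.
move=> wN; have [nw e2] := legal_next ls wN.
have eV : (s w `<=` V)%fset.
  apply: (@queries_vertices N s (rcons w true)); first by rewrite size_rcons.
  by rewrite queries_rcons mem_rcons mem_head.
have [[a b] /= ab eab] := edge_surj e2 eV; exists a, b; split => // c x y.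
rewrite /dft /defect /Q /B /edge_rel /light_built light_queries_rcons built_rcons.
rewrite !mem_filter; case: (light s D w); last first.
  rewrite mul0r addr0; congr (_%:R - _); case: c => //.
  rewrite mem_rcons inE; case: eqP => //= ->.
  have -> : s w \in light_queries s D w = false.
    by apply: contraNF nw; exact: light_subset.
  by rewrite andbF.
rewrite /edge_ind -edge_eq -eab mem_rcons inE; case: eqP => [->|ne] /=.
  have -> : s w \in light_queries s D w = false.
    by apply: contraNF nw; exact: light_subset.
  have nb : s w \in built s w = false by apply: contraNF nw; exact: built_subset.
  by case: c; rewrite ?mem_rcons ?inE ?eqxx ?nb /=; ring.
rewrite mulr0 addr0; congr (_%:R - _); case: c => //.
by rewrite mem_rcons inE; case: eqP.
Qed.

Lemma defect_sym w x y : dft w x y = dft w y x.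
Proof. by rewrite /dft /defect /Q /B !(edge_rel_sym _ x). Qed.

Lemma defect_row w x : \sum_y dft w x y ^+ 2 <= D%:R.
Proof.
apply: (@le_trans _ _ (\sum_y (Q w x y)%:R)).
  apply: ler_sum => y _; rewrite /dft /defect.
  have := @light_built_sub w x y; case: (B w x y); case: (Q w x y) => h;
    rewrite ?mulr0 ?mulr1 ?subr0 ?expr0n ?sub0r //=.
  - by rewrite expr_le1 // ?subr_ge0 // lerBlDr lerDl.
  - by have := h isT.
  - by rewrite sqrrN expr_le1.
apply: le_trans (edge_degree _ _ _) _.
by rewrite ler_nat light_degree.
Qed.

Lemma mean_energy : mean p N (fun w => quad_energy (dft w)) <= N%:R * (36 * D%:R + 16).
Proof.
apply: mean_increment_le => //; last first.
  rewrite /quad_energy big1 // => x _; rewrite big1 // => y _.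
  rewrite big1 ?expr0n // => z _.
  by rewrite /dft /defect /Q /B /edge_rel /= !mulr0 subr0 mul0r.
move=> w wN; have [a [b [ab E]]] := defect_rcons wN.
pose L := 2 * \sum_x \sum_y (\sum_z dft w x z * dft w z y) *
  (\sum_z (dft w x z * edge_ind R a b z y + edge_ind R a b x z * dft w z y)).
exists (if light s D w then L else 0) => c.
pose d : R := if light s D w then c%:R - p else 0.
have d1 : `|d| <= 1.
  rewrite /d; case: ifP => _; last by rewrite normr0.
  by rewrite ler_norml; case: c {d}; rewrite ?mulr1n ?mulr0n; apply/andP; split; move: p0 p1; lra.
have -> : quad_energy (dft (rcons w c)) =
    quad_energy (fun x y => dft w x y + d * edge_ind R a b x y).
  apply: eq_bigr => x _; apply: eq_bigr => y _; congr (_ ^+ 2).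
  by apply: eq_bigr => z _; rewrite !E.
apply: le_trans (quad_energy_step ab (@defect_sym w) d1 (@defect_row w)) _.
rewrite -/L /d; case: ifP => _; lra.
Qed.

Lemma mean_defect : mean p N (fun w => \sum_x \sum_y dft w x y) = 0.
Proof.
pose X w := \sum_x \sum_y dft w x y.
have X0 : X [::] = 0.
  rewrite /X big1 // => x _; rewrite big1 // => y _.
  by rewrite /dft /defect /Q /B /edge_rel /= !mulr0 subr0.
have XS w : (size w < N)%N -> exists z, forall b, X (rcons w b) = X w + (b%:R - p) * z.
  move=> wN; have [a [b [ab E]]] := defect_rcons wN.
  exists (if light s D w then \sum_x \sum_y edge_ind R a b x y else 0) => c.
  transitivity (\sum_x \sum_y (dft w x y + (if light s D w then c%:R - p else 0) *
    edge_ind R a b x y)).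
    by apply: eq_bigr => x _; apply: eq_bigr => y _; rewrite E.
  under eq_bigr => x _ do rewrite big_split /= -mulr_sumr.
  by rewrite big_split /= -mulr_sumr; case: ifP => _; rewrite ?mul0r ?mulr0.
have h1 : mean p N X <= N%:R * 0.
  apply: mean_increment_le => //; last by rewrite X0.
  by move=> w /XS[z zE]; exists z => b; rewrite zE addr0.
have h2 : mean p N (fun w => -1 * X w) <= N%:R * 0.
  apply: mean_increment_le => //; last by rewrite X0 mulr0.
  by move=> w /XS[z zE]; exists (- z) => b; rewrite zE addr0 mulrN mulrDr !mulN1r.
rewrite meanZ mulr0 mulN1r oppr_le0 in h2; rewrite mulr0 in h1.
by apply/eqP; rewrite eq_le h1 h2.
Qed.

Lemma rt_ge0 : 0 <= rt. Proof. exact: sqrtr_ge0. Qed.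

Lemma rt_sq : rt ^+ 2 = 2 * N%:R.
Proof. by rewrite sqr_sqrtr // mulr_ge0. Qed.

Lemma clique_count_edges (E : seq pair_of_vertices) (I : finType) (v0 : V)
    (S : {set I}) : (forall e, e \in E -> #|` e| = 2%N) -> (size E <= N)%N ->
  #|S| != 1%N -> clique_count R v0 (@edge_rel V E) S <= rt ^+ #|S|.
Proof.
move=> E2 EN S1.
rewrite -(@ler_pXn2r _ 2) ?nnegrE ?clique_count_ge0 ?exprn_ge0 ?rt_ge0 //.
apply: le_trans (clique_count_sq _ _ _ S1) _.
rewrite exprAC rt_sq -[_ * N%:R]natrM.
apply: lerXn2r; rewrite ?nnegrE ?rel_mass_ge0 //.
by apply: le_trans (edge_mass _ _ E2) _; rewrite ler_nat leq_mul2l EN.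
Qed.

Variable m : nat.
Hypothesis m2 : (2 <= m)%N.

Definition cliques (E : seq bool -> rel V) w : R :=
  \sum_(f : {ffun 'I_m -> V}) (clique (E w) [set: 'I_m] f)%:R.

Let k := 'C(m, 2).

Lemma light_query2 w : (size w <= N)%N ->
  forall e, e \in light_queries s D w -> #|` e| = 2%N.
Proof. by move=> /(legal_prefix ls)[_ h] e /light_subset; exact: h. Qed.

Lemma vertex_exists : (0 < N)%N -> V.
Proof.
move=> N0; have [_ e2] := @legal_next N s ls [::] N0.
have eV : (s [::] `<=` V)%fset.
  apply: (@queries_vertices N s [:: true]) => //.
  by rewrite (@queries_rcons s [::]) mem_rcons mem_head.
have /cid[[a b] _] : exists ab : V * V, s [::] = edge ab.1 ab.2.
  by have [ab _ ?] := edge_surj e2 eV; exists ab.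
exact: a.
Qed.

Lemma cliques_le w : (0 < N)%N -> (size w <= N)%N -> cliques Q w <= rt ^+ m.
Proof.
move=> /vertex_exists v0 wN.
have -> : cliques Q w = clique_count R v0 (Q w) [set: 'I_m].
  by apply: eq_bigl => f; rewrite pinned_setT.
have cm : #|[set: 'I_m]| = m by rewrite cardsT card_ord.
apply: le_trans (clique_count_edges _ _ _ _) _; rewrite ?cm //; first exact: light_query2.
  exact: leq_trans (size_light _ _ _) wN.
by case: (m) m2 => [|[|]].
Qed.

Lemma mean_cliques (lam : R) : (2 < m)%N -> (0 < N)%N -> 0 < lam ->
  `|mean p N (cliques B) - p ^+ k * mean p N (cliques Q)| <=
  k%:R * ((lam + N%:R * (36 * D%:R + 16) / lam ^+ 3) * rt ^+ m.-1).
Proof.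
move=> m3 /vertex_exists v0 lam0.
have l3 : 0 < (lam ^+ 3)^-1 by rewrite invr_gt0 exprn_gt0.
rewrite -meanZ -meanB; apply: le_trans (mean_norm p0 p1 _ _) _.
apply: (@le_trans _ _ (mean p N (fun w => k%:R * rt ^+ m.-1 * lam +
  (k%:R * rt ^+ m.-1 / lam ^+ 3) * quad_energy (dft w)))).
  apply: le_mean => // w wN.
  apply: le_trans (@counting R m V v0 (Q w) (B w) (edge_rel_sym _) (edge_rel_sym _)
    (@light_built_sub w) p lam (rt ^+ m.-1) p0 p1 lam0 _) _.
    move=> S Sm; rewrite -Sm; apply: clique_count_edges.
    - by apply: light_query2; rewrite wN.
    - by apply: leq_trans (size_light _ _ _) _; rewrite wN.
    - by rewrite Sm; case: (m) m3 => [|[|[|]]].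
  by rewrite le_eqVlt; apply/orP; left; apply/eqP; rewrite -/k; ring.
rewrite meanD mean_cst meanZ.
have : 0 <= k%:R * rt ^+ m.-1 / lam ^+ 3.
  by rewrite !mulr_ge0 ?exprn_ge0 ?rt_ge0 // ltW.
move=> /ler_wpM2l /(_ _ _ mean_energy) h; apply: le_trans (lerD (lexx _) h) _.
by rewrite le_eqVlt; apply/orP; left; apply/eqP; ring.
Qed.

Lemma mean_cliques2 : m = 2%N -> (0 < N)%N ->
  mean p N (cliques B) = p ^+ k * mean p N (cliques Q).
Proof.
move=> mE /vertex_exists v0; apply/eqP; rewrite -subr_eq0 -meanZ -meanB -mean_defect.
apply/eqP/eq_mean => w _; rewrite /cliques /k; rewrite mE.
rewrite !(sum_clique2 R v0 (edge_rel_sym _)) binn expr1 /rel_mass mulr_sumr -sumrB.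
by apply: eq_bigr => x _; rewrite mulr_sumr -sumrB.
Qed.

Definition heavy_vertices w : pred V := [pred x | D <= degree s w (val x)]%N.

Lemma heavy_card w : (size w <= N)%N -> D%:R * #|heavy_vertices w|%:R <= rt ^+ 2.
Proof.
move=> wN; have [_ q2] := legal_prefix ls wN.
rewrite rt_sq -!natrM ler_nat.
apply: leq_trans (_ : 2 * size (queries s w) <= _)%N; last by rewrite size_queries leq_mul2l wN.
apply: leq_trans (sum_degree V q2).
rewrite mulnC -sum_nat_const [leqLHS]big_mkcond; apply: leq_sum => x _.
by rewrite inE; case: ifP.
Qed.

Lemma heavy_card0 w : (size w <= N)%N -> (N < D)%N -> #|heavy_vertices w| = 0%N.
Proof.
move=> wN ND; apply: eq_card0 => x; rewrite inE; apply/negbTE; rewrite -ltnNge.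
apply: leq_ltn_trans ND; apply: leq_trans wN.
by rewrite /degree (leq_trans (count_size _ _)) // size_queries.
Qed.

Lemma cliques_heavy (v0 : V) w : (size w <= N)%N ->
  cliques Ball w <= cliques B w +
    #|heavy_vertices w|%:R * \sum_(i < m) clique_count R v0 (Qall w) ([set: 'I_m] :\ i).
Proof.
move=> wN.
apply: (@le_trans _ _ (cliques B w + \sum_(i < m) \sum_(f : {ffun 'I_m -> V})
    (clique (Qall w) [set: 'I_m] f && heavy_vertices w (f i))%:R)); last first.
  rewrite lerD2l mulr_sumr; apply: ler_sum => i _.
  have := @clique_count_drop1 R _ V v0 (Qall w) [set: 'I_m] i (heavy_vertices w).
  rewrite inE => /(_ isT); apply: le_trans; rewrite le_eqVlt; apply/orP; left; apply/eqP.
  by apply: eq_bigl => f; rewrite pinned_setT.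
rewrite exchange_big -big_split; apply: ler_sum => f _ /=.
have [/cliqueP cB|//] := boolP (clique (Ball w) _ f); last first.
  by rewrite addr_ge0 // sumr_ge0.
have [//|nB] := boolP (clique (B w) _ f); first by rewrite lerDl sumr_ge0.
rewrite add0r.
have [i hi] : exists i, heavy_vertices w (f i).
  move: nB => /forall_inPn[i iT] /forall_inPn[j jT]; rewrite negb_imply => /andP[ij nB].
  have bij := cB i j iT jT ij; have qij := built_subset bij.
  have nl : edge (f i) (f j) \notin light_queries s D w.
    by apply: contra nB => l; rewrite /B /edge_rel mem_filter l andbT.
  have [x] := heavy_query qij nl.
  by rewrite !inE => /orP[]/eqP -> h; [exists i|exists j].
rewrite (bigD1 i) //= hi andbT.
have -> : clique (Qall w) [set: 'I_m] f.
  by apply/cliqueP => i' j' iT jT ij; apply: built_subset; apply: cB.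
by rewrite lerDl sumr_ge0.
Qed.

Lemma expected_copiesE :
  expected_copies (@complete_graph m) p N s = mean p N (cliques Ball).
Proof.
apply: eq_bigr => w _; congr (_ * _).
have wN : (size w <= N)%N by rewrite size_tuple.
rewrite (@num_copies_clique m V) //.
- rewrite -sum1_card natr_sum big_mkcond; apply: eq_bigr => f _.
  by rewrite inE; case: ifP.
- by move=> e /built_subset; apply: (legal_prefix ls wN).2.
- by move=> e /built_subset; apply: queries_vertices.
Qed.

Lemma cliques_light_le w : cliques B w <= cliques Ball w.
Proof.
apply: ler_sum => f _; rewrite ler_nat; case: cliqueP => // h; rewrite lt0b.
apply/cliqueP => i j iT jT ij; have := h i j iT jT ij.
by rewrite /B /edge_rel mem_filter => /andP[].
Qed.

End CopiesOnAverage.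

(** * The clique strategy *)

Section GreedyClique.

Fixpoint pairs_below n : seq pair_of_vertices :=
  if n is n'.+1 then
    pairs_below n' ++ [seq [fset i%:Z; n'%:Z]%fset | i <- iota 0 n']
  else [::].

Lemma size_pairs_below n : size (pairs_below n) = 'C(n, 2).
Proof.
by elim: n => //= n IH; rewrite size_cat size_map size_iota IH binS bin1 addnC.
Qed.

Lemma pairs_below_lt n e (x : int) : e \in pairs_below n -> x \in e -> x < n%:Z.
Proof.
elim: n => //= n IH; rewrite mem_cat => /orP[en xe|/mapP[i]].
  by apply: lt_trans (IH en xe) _; rewrite ltz_nat.
rewrite mem_iota => /andP[_ iN] ->; rewrite !inE => /orP[]/eqP ->; rewrite ltz_nat //.
exact: ltnW.
Qed.

Lemma mem_pairs_below n (i j : nat) : (i < n)%N -> (j < n)%N -> i != j ->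
  [fset i%:Z; j%:Z]%fset \in pairs_below n.
Proof.
wlog ij : i j / (i < j)%N.
  move=> H iN jN ij; have [lij|] := ltnP i j; first exact: H.
  rewrite leq_eqVlt eq_sym (negbTE ij) /= => lji.
  by rewrite fsetUC; apply: H; rewrite // eq_sym.
move=> _ jN _; elim: n jN => // n IH; rewrite ltnS leq_eqVlt /= mem_cat.
case/orP=> [/eqP jn|/IH -> //]; apply/orP; right; apply/mapP; exists i.
  by rewrite mem_iota add0n -jn.
by rewrite jn.
Qed.

Lemma pairs_below_card n e : e \in pairs_below n -> #|` e| = 2%N.
Proof.
elim: n => //= n IH; rewrite mem_cat => /orP[/IH //|/mapP[i]].
rewrite mem_iota => /andP[_ iN] ->; rewrite cardfs2; case: eqP => // -[ij].
by rewrite ij ltnn in iN.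
Qed.

Lemma pairs_below_uniq n : uniq (pairs_below n).
Proof.
elim: n => //= n IH; rewrite cat_uniq IH /=; apply/andP; split.
  apply/hasPn => e /mapP[i _ ->]; apply/negP => h.
  have : n%:Z < n%:Z by apply: (pairs_below_lt h); rewrite !inE eqxx orbT.
  by rewrite ltxx.
rewrite map_inj_in_uniq ?iota_uniq // => i j; rewrite !mem_iota !add0n => iN jN E.
have : i%:Z \in [fset j%:Z; n%:Z]%fset by rewrite -E !inE eqxx.
by rewrite !inE => /orP[/eqP[]//|/eqP[] ij]; move: iN; rewrite ij ltnn.
Qed.

Lemma pairs_below_degree n (x : int) :
  (count (fun e : pair_of_vertices => x \in e) (pairs_below n) <= n)%N.
Proof.
elim: n => //= n IH; rewrite count_cat.
have [->|xn] := eqVneq x n%:Z.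
  have -> : count (fun e : pair_of_vertices => n%:Z \in e) (pairs_below n) = 0%N.
    apply/eqP; rewrite -leqn0 leqNgt -has_count; apply/hasPn => e en.
    by apply/negP => /(pairs_below_lt en); rewrite ltxx.
  by rewrite add0n (leq_trans (count_size _ _)) // size_map size_iota.
rewrite -addn1; apply: leq_add IH _; rewrite count_map.
apply: (@leq_trans (count (fun i : nat => x == i%:Z) (iota 0 n))).
  by apply: sub_count => i /=; rewrite !inE (negbTE xn) orbF.
case: x {xn} => [k|k]; last by rewrite (@eq_count _ _ pred0) ?count_pred0.
rewrite (@eq_count _ _ (pred1 k)); last by move=> i; rewrite /= eq_sym.
by rewrite count_uniq_mem ?iota_uniq // leq_b1.
Qed.

Lemma pairs_below_cat n d : exists r, pairs_below (n + d) = pairs_below n ++ r.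
Proof.
elim: d => [|d [r E]]; first by exists [::]; rewrite addn0 cats0.
by rewrite addnS /= E -catA; eexists.
Qed.

Variable N : nat.

Definition greedy : strategy := fun h => nth fset0 (pairs_below N.+2) (size h).

Lemma size_greedy : (N <= size (pairs_below N.+2))%N.
Proof. by rewrite size_pairs_below binS bin1; apply: leq_trans (leq_addl _ _). Qed.

Lemma queries_greedy w : (size w <= N)%N ->
  queries greedy w = take (size w) (pairs_below N.+2).
Proof.
move=> wN; have wP := leq_trans wN size_greedy.
apply: (@eq_from_nth _ fset0); first by rewrite size_queries size_takel.
rewrite size_queries => i iw; rewrite (nth_map 0%N) ?size_iota // nth_iota // add0n.
by rewrite /greedy size_takel ?nth_take // ltnW.
Qed.

Lemma greedy_legal : legal N greedy.
Proof.
move=> w; rewrite queries_greedy ?size_tuple //; split.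
  by apply: take_uniq; exact: pairs_below_uniq.
by move=> e /mem_take; exact: pairs_below_card.
Qed.

Variables (n D : nat).
Hypotheses (nN : (n <= N.+2)%N) (nN2 : ('C(n, 2) <= N)%N) (nD : (n < D)%N).

Lemma greedy_light w (e : pair_of_vertices) : size w = N ->
  e \in pairs_below n -> e \in light_queries greedy D w.
Proof.
move=> wN en; have [r Pr] := pairs_below_cat n (N.+2 - n).
rewrite subnKC // in Pr; set i := index e (pairs_below n).
have iC : (i < 'C(n, 2))%N by rewrite -size_pairs_below index_mem.
have iN := leq_trans iC nN2; have iw : size (take i w) = i by rewrite size_takel // wN ltnW.
have ie : greedy (take i w) = e.
  by rewrite /greedy iw Pr nth_cat size_pairs_below iC nth_index.
apply/mapP; exists i => //; rewrite mem_filter mem_iota add0n wN iN /= andbT.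
apply/allP => x _; apply: leq_ltn_trans nD; apply: leq_trans (pairs_below_degree n x).
rewrite /degree queries_greedy iw; last exact: ltnW.
rewrite Pr takel_cat; last by rewrite size_pairs_below ltnW.
by rewrite -[in leqRHS](cat_take_drop i (pairs_below n)) count_cat leq_addr.
Qed.

Lemma greedy_cliques (R : realType) m w : (2 <= m)%N -> size w = N ->
  (n ^_ m)%:R <= @cliques R N greedy m
    (fun w' => @edge_rel (vertices N greedy) (light_queries greedy D w')) w.
Proof.
move=> m2 wN; have wN' : (size w <= N)%N by rewrite wN.
have E2 e : e \in light_queries greedy D w -> #|` e| = 2%N.
  by apply: (light_query2 greedy_legal wN').
have EV e : e \in light_queries greedy D w -> (e `<=` vertices N greedy)%fset.
  by move=> /light_subset; exact: queries_vertices.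
have -> : @cliques R N greedy m
    (fun w' => @edge_rel (vertices N greedy) (light_queries greedy D w')) w =
    (num_copies (@complete_graph m) (light_queries greedy D w))%:R.
  rewrite (num_copies_clique m2 E2 EV) -sum1_card natr_sum big_mkcond.
  by apply: eq_bigr => f _; rewrite inE; case: ifP.
rewrite ler_nat -{1}(card_ord n) -{1}(card_ord m) -card_inj_ffuns.
pose F (g : {ffun 'I_m -> 'I_n}) := [ffun v => (g v : nat)%:Z] : {ffun 'I_m -> int}.
rewrite cardE -(size_map F); apply: uniq_leq_size.
  rewrite map_inj_uniq ?enum_uniq // => g h /ffunP gh; apply/ffunP => i.
  by have := gh i; rewrite !ffunE => -[] /val_inj.
move=> f /mapP[g]; rewrite mem_enum inE => /injectiveP ginj ->.
rewrite in_fset_set; last exact/finite_copies/complete_graph_no_isolated.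
rewrite inE; split => [i j|i j ij]; rewrite !ffunE; first by move=> -[] /val_inj /ginj.
apply: greedy_light => //; apply: mem_pairs_below => //.
by apply: contra ij => /eqP/val_inj/ginj ->.
Qed.

End GreedyClique.

Section Asymptotics.
Variable R : realType.
Implicit Types (s t : R).

Lemma bernoulli_le (x : R) m : 0 <= x -> x <= 1 -> 1 - m%:R * x <= (1 - x) ^+ m.
Proof.
move=> x0 x1; elim: m => [|m IH]; first by rewrite mul0r subr0.
rewrite exprS -natr1; have mx : 0 <= m%:R * x by rewrite mulr_ge0.
apply: le_trans (ler_wpM2l _ IH); last by rewrite subr_ge0.
by have := mulr_ge0 mx x0; nra.
Qed.

Lemma ffact_lower s m n : m.+1%:R <= s -> s < n.+1%:R ->
  s ^+ m * (1 - m%:R * (m.+1%:R / s)) <= (n ^_ m)%:R.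
Proof.
move=> ms sn; have s0 : 0 < s by apply: lt_le_trans ms; rewrite ltr0n.
have x0 : 0 <= m.+1%:R / s by rewrite divr_ge0 // ltW.
have x1 : m.+1%:R / s <= 1 by rewrite ler_pdivrMr // mul1r.
apply: le_trans (ler_wpM2l (exprn_ge0 m (ltW s0)) (bernoulli_le m x0 x1)) _.
rewrite -exprMn mulrBr mulr1 mulrCA divff ?gt_eqF // mulr1.
have mn : (m <= n)%N by apply/ltnW; rewrite -ltnS -(ltr_nat R); exact: le_lt_trans ms sn.
apply: (@le_trans _ _ (((n - m) ^ m)%N%:R)).
  rewrite natrX; apply: lerXn2r; rewrite ?nnegrE ?subr_ge0 //.
  by rewrite natrB //; move: sn; rewrite -!natr1; lra.
rewrite ler_nat ffact_prod -[X in ((n - m) ^ X)%N]card_ord -prod_nat_const.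
by apply: leq_prod => i _; rewrite leq_sub2l // ltnW.
Qed.

Lemma error_terms (m k : nat) t : 0 < t ->
  exists s0 : R, 0 < s0 /\ forall s (N : nat), s0 <= s -> s ^+ 2 = 2 * N%:R ->
    exists lam (D : nat), [/\ 0 < lam,
      k%:R * (lam + N%:R * (36 * D%:R + 16) / lam ^+ 3) <= t * s,
      m%:R * (s ^+ 2 / D%:R) <= t * s & s + 1 < D%:R].
Proof.
move=> t0; have k0 : 0 <= k%:R :> R by [].
have m0 : 0 <= m%:R :> R by [].
have k1 : 0 < k%:R + 1 :> R by rewrite natr1 ltr0n.
pose d : R := t / (2 * (k%:R + 1)); have d0 : 0 < d by rewrite divr_gt0 // mulr_gt0.
have dE : k%:R * d <= t / 2.
  have -> : t / 2 = (k%:R + 1) * d by rewrite /d; field; rewrite gt_eqF.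
  by rewrite ler_pM2r //; lra.
pose L : R := 2 + m%:R / t; have L0 : 0 < L by rewrite ltr_wpDr // divr_ge0 // ltW.
have d3 : 0 < d ^+ 3 by rewrite exprn_gt0.
pose A : R := (18 * L + 26) / d ^+ 3.
have A0 : 0 <= A by rewrite divr_ge0 ?ltW // addr_gt0 // mulr_gt0.
exists (1 + 2 * k%:R * A / t).
have h0 : 0 <= 2 * k%:R * A / t.
  by apply: divr_ge0; [apply: mulr_ge0 => //; exact: mulr_ge0 | exact: ltW].
split; first by rewrite ltr_wpDr.
move=> s N s0s sN.
have s1 : 1 <= s by apply: le_trans s0s; rewrite lerDl.
have s0 : 0 < s by apply: lt_le_trans s1.
have kA : k%:R * A <= t / 2 * s.
  have : 2 * k%:R * A / t <= s by apply: le_trans s0s; rewrite lerDr.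
  rewrite ler_pdivrMr //; lra.
exists (d * s), (Num.truncn (L * s)).+1.
have Ls0 : 0 <= L * s by rewrite mulr_ge0 ?ltW.
have /andP[D1 D2] := truncn_itv Ls0.
set D := (Num.truncn (L * s)).+1 in D2 *.
have D3 : D%:R <= L * s + 1 by rewrite /D -natr1 lerD2r.
have D0 : 0 < D%:R :> R by rewrite ltr0n.
have Nr : N%:R = s ^+ 2 / 2 by rewrite sN mulrAC divff ?mul1r.
split.
- by rewrite mulr_gt0.
- have h : N%:R * (36 * D%:R + 16) / (d * s) ^+ 3 <= A.
    rewrite exprMn ler_pdivrMr ?mulr_gt0 ?exprn_gt0 // /A mulrA divfK ?gt_eqF // Nr.
    have -> : s ^+ 3 = s ^+ 2 * s by rewrite exprSr.
    have : 0 <= s ^+ 2 by exact: sqr_ge0.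
    move=> s2; rewrite mulrCA -mulrA; apply: ler_wpM2l => //.
    rewrite -(ler_pM2l (_ : 0 < 2 :> R)) // mulrA divff // mul1r.
    nra.
  have := ler_wpM2l k0 h; have : k%:R * (d * s) <= t / 2 * s.
    by rewrite mulrA ler_wpM2r // ltW.
  rewrite mulrDr; lra.
- rewrite mulrA ler_pdivrMr // expr2 mulrA [t * s]mulrC -!mulrA [m%:R * (s * s)]mulrCA.
  apply: ler_wpM2l; first exact: ltW.
  have : m%:R * s <= t * (L * s).
    have -> : t * (L * s) = (2 * t + m%:R) * s by rewrite /L; field; rewrite gt_eqF.
    by apply: ler_wpM2r; [exact: ltW | lra].
  by move=> h; apply: le_trans h _; rewrite ler_pM2l // ltW.
- apply: le_lt_trans D2; rewrite /L mulrDl.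
  have : 0 <= m%:R / t * s by rewrite !mulr_ge0 ?invr_ge0 // ltW.
  lra.
Qed.

End Asymptotics.

Lemma sq_le_double n N : (n * n <= 2 * N)%N -> (n <= N.+2)%N /\ ('C(n, 2) <= N)%N.
Proof.
move=> h; split; last first.
  rewrite bin2 -divn2; apply: leq_trans (leq_div2r 2 (_ : _ <= 2 * N)%N) _; last by rewrite mulKn.
  by apply: leq_trans h; rewrite leq_mul2l leq_pred orbT.
rewrite leqNgt; apply/negP => nN.
have := leq_mul nN (leqnn n); have := leq_mul (leqnn N.+3) nN; lia.
Qed.

Section Bounds.
Variables (R : realType) (p : R) (m : nat).
Hypotheses (p0 : 0 < p) (p1 : p < 1) (m2 : (2 <= m)%N).
Let k := 'C(m, 2).

Lemma copies_bounds (t : R) : 0 < t ->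
  exists s0 : R, 0 < s0 /\ forall N : nat, (0 < N)%N -> s0 <= Num.sqrt (2 * N%:R) ->
  let s := Num.sqrt (2 * N%:R) in
  p ^+ k * s ^+ m * (1 - m%:R * (m.+1%:R / s)) - t * s ^+ m <=
    max_copies (@complete_graph m) p N <= p ^+ k * s ^+ m + 2 * t * s ^+ m.
Proof.
move=> t0; have [s1 [s10 H]] := error_terms m k t0.
have m10 : 0 < m.+1%:R :> R by rewrite ltr0n.
exists (s1 + m.+1%:R); split; first exact: addr_gt0.
move=> N N0; set s := Num.sqrt _ => s1s /=.
have sN : s ^+ 2 = 2 * N%:R by exact: rt_sq.
have s1s' : s1 <= s by apply: le_trans s1s; rewrite lerDl ltW.
have ms : m.+1%:R <= s by apply: le_trans s1s; rewrite lerDr ltW.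
have s0 : 0 < s by exact: lt_le_trans ms.
have [lam [D [lam0 e1 e2 sD]]] := H s N s1s' sN.
have m1 : s * s ^+ m.-1 = s ^+ m by rewrite -exprS prednK // ltnW.
have sm1 : 0 <= s ^+ m.-1 by rewrite exprn_ge0 // ltW.
have pk : 0 <= p ^+ k by rewrite exprn_ge0 // ltW.
have p0' := ltW p0; have p1' := ltW p1.
have noH := complete_graph_no_isolated m2.
pose D' := if (2 < m)%N then D else (N + D)%N.+1.
have sD' : s + 1 < D'%:R.
  rewrite /D'; case: ifP => // _; apply: lt_le_trans sD _.
  by rewrite ler_nat; apply: leqW; exact: leq_addl.
pose Q u w := @edge_rel (vertices N u) (light_queries u D' w).
pose B u w := @edge_rel (vertices N u) (light_built u D' w).
have core u : legal N u ->
    `|mean p N (@cliques R N u m (B u)) - p ^+ k * mean p N (@cliques R N u m (Q u))|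
    <= t * s ^+ m.
  move=> lu; have [m3|m3] := ltnP 2 m; last first.
    have mE : m = 2%N by apply/eqP; rewrite eqn_leq m3.
    rewrite (mean_cliques2 D' p0' p1' lu mE N0) subrr normr0.
    by rewrite mulr_ge0 // ?exprn_ge0 // ltW.
  apply: le_trans (mean_cliques D' p0' p1' lu m3 N0 lam0) _.
  rewrite mulrA -/k -/s -m1 [t * _]mulrA; apply: ler_wpM2r => //.
  by rewrite /D' m3.
apply/andP; split.
- pose n := Num.truncn s.
  have /andP[n1 n2] := truncn_itv (ltW s0); rewrite -/n in n1 n2.
  have nn : (n * n <= 2 * N)%N.
    by rewrite -(ler_nat R) !natrM -sN expr2 ler_pM.
  have [nN nC] := sq_le_double nn.
  have nD : (n < D')%N.
    rewrite -(ltr_nat R); apply: le_lt_trans n1 _.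
    by apply: lt_trans sD'; rewrite ltrDl.
  have lg : legal N (greedy N) by exact: greedy_legal.
  apply: le_trans (max_copies_ub _ noH lg); rewrite expected_copiesE //.
  apply: (@le_trans _ _ (mean p N (@cliques R N (greedy N) m (B (greedy N))))); last first.
    by apply: le_mean => // w _; exact: cliques_light_le.
  have := core _ lg; rewrite ler_norml => /andP[h _].
  suff: p ^+ k * s ^+ m * (1 - m%:R * (m.+1%:R / s)) <=
      p ^+ k * mean p N (@cliques R N (greedy N) m (Q (greedy N))) by lra.
  rewrite -mulrA; apply: ler_wpM2l => //; apply: le_trans (ffact_lower ms n2) _.
  rewrite -[leLHS](mean_cst p N); apply: le_mean => // w wN.
  exact: greedy_cliques.
- have [u lu <-] := max_copies_attained p N noH; rewrite expected_copiesE //.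
  have v0 := vertex_exists lu N0.
  have step : mean p N (@cliques R N u m (fun w => @edge_rel (vertices N u) (built u w))) <=
      mean p N (@cliques R N u m (B u)) + t * s ^+ m.
    rewrite -[t * _](mean_cst p N) -meanD; apply: le_mean => // w wN.
    have wN' : (size w <= N)%N by rewrite wN.
    apply: le_trans (cliques_heavy R D' m v0 wN') _; rewrite lerD2l.
    have [m3|m3] := ltnP 2 m; last first.
      rewrite heavy_card0 // ?mul0r ?mulr_ge0 ?exprn_ge0 // ?ltW //.
      by rewrite /D' [(2 < m)%N]ltnNge m3 /= ltnS leq_addr.
    have hc := heavy_card R D' lu wN'; rewrite -/s in hc.
    have D0 : 0 < D'%:R :> R by apply: lt_trans sD'; rewrite ltr_wpDr.
    rewrite mulrC -ler_pdivlMr // in hc.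
    apply: (@le_trans _ _ (s ^+ 2 / D'%:R * (m%:R * s ^+ m.-1))).
      apply: ler_pM => //; first by apply: sumr_ge0 => i _; exact: clique_count_ge0.
      have -> : m%:R * s ^+ m.-1 = \sum_(i < m) s ^+ m.-1.
        by rewrite sumr_const card_ord mulr_natl.
      apply: ler_sum => i _.
      have Si : #|[set: 'I_m] :\ i| = m.-1.
        have := cardsD1 i [set: 'I_m]; rewrite inE cardsT card_ord add1n.
        by move/(congr1 predn) => /= <-.
      rewrite -Si; apply: clique_count_edges.
      + exact: (legal_prefix lu wN').2.
      + by rewrite size_queries.
      + by rewrite Si; case: (m) m3 => [|[|[|]]].
    rewrite mulrCA mulrA -m1 [t * _]mulrA; apply: ler_wpM2r => //.
    by rewrite /D' m3.
  apply: le_trans step _.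
  have := core _ lu; rewrite ler_norml => /andP[_ h].
  suff: p ^+ k * mean p N (@cliques R N u m (Q u)) <= p ^+ k * s ^+ m by lra.
  apply: ler_wpM2l => //; rewrite -[leRHS](mean_cst p N).
  by apply: le_mean => // w wN; apply: cliques_le; rewrite // wN.
Qed.

End Bounds.

Theorem theorem15 (R : realType) (m : nat) (p eps : R) :
  (2 <= m)%N -> 0 < p -> p < 1 -> 0 < eps ->
  exists C : R, 0 < C /\
    forall N : nat, (0 < N)%N ->
      C * p ^- (2 * m - 1) * (ln p^-1) ^+ 2 <= N%:R ->
      (1 - eps) * (p ^+ 'C(m, 2) * (2 * N%:R) `^ (m%:R / 2))
        <= max_copies (@complete_graph m) p N
        <= (1 + eps) * (p ^+ 'C(m, 2) * (2 * N%:R) `^ (m%:R / 2)).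
Proof.
move=> m2 p0 p1 eps0; set P := p ^+ 'C(m, 2).
have P0 : 0 < P by rewrite exprn_gt0.
have t0 : 0 < eps * P / 2 by rewrite !mulr_gt0.
have [s1 [s10 H]] := copies_bounds p0 p1 m2 t0.
pose s2 := 2 * m%:R * m.+1%:R / eps.
have s20 : 0 < s2 by rewrite !mulr_gt0 ?invr_gt0 // ltr0n // ltnW.
pose s0 := s1 + s2; have s00 : 0 < s0 by exact: addr_gt0.
pose c := p ^- (2 * m - 1) * (ln p^-1) ^+ 2.
have c0 : 0 < c.
  by rewrite mulr_gt0 ?invr_gt0 ?exprn_gt0 // ln_gt0 // invf_gt1.
exists (s0 ^+ 2 / c); split; first by rewrite divr_gt0 // exprn_gt0.
move=> N N0; rewrite -mulrA -/c divfK ?gt_eqF // => sN.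
have N2 : 0 <= 2 * N%:R :> R by rewrite mulr_ge0.
have -> : (2 * N%:R) `^ (m%:R / 2) = Num.sqrt (2 * N%:R) ^+ m :> R.
  by rewrite [m%:R / 2]mulrC powRrM powR12_sqrt // powR_mulrn ?sqrtr_ge0.
have s0s : s0 <= Num.sqrt (2 * N%:R).
  apply: le_trans (_ : Num.sqrt (s0 ^+ 2) <= _); first by rewrite sqrtr_sqr ler_norm.
  apply: ler_wsqrtr.
  by apply: le_trans sN _; rewrite ler_peMl // ler1n.
have s1s : s1 <= Num.sqrt (2 * N%:R) by apply: le_trans s0s; rewrite lerDl ltW.
have s2s : s2 <= Num.sqrt (2 * N%:R) by apply: le_trans s0s; rewrite lerDr ltW.
have /= := H N N0 s1s; set s := Num.sqrt _ in s0s s1s s2s *; rewrite -/P.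
have sp : 0 < s by exact: lt_le_trans s2s.
have S0 : 0 <= P * s ^+ m by rewrite mulr_ge0 ?exprn_ge0 // ltW.
have small : m%:R * (m.+1%:R / s) <= eps / 2.
  move: s2s; rewrite /s2 ler_pdivrMr // mulrA ler_pdivrMr //; lra.
move: small S0; move: (m%:R * _) (s ^+ m) => x sm small S0 /andP[h1 h2].
have h := ler_wpM2l S0 small.
by apply/andP; split; [apply: le_trans h1 | apply: le_trans h2 _]; lra.
Qed.
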